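(* Fix $B,A_0>0$. Uniformly for positive odd integers $h\le(\log x)^{A_0}$ (for all sufficiently large $x$), $$S_h^\varphi(x)\ll_{A_0,B}x e^{-BG}.$$
   Context: $\varphi$ is Euler's totient function; $\log_j x$ is the $j$-fold iterated logarithm; $G=(\log x\cdot\mathcal A)^{1/2}$ with $\mathcal A=\log_3 x+\log_4 x-\log 2$ ($x$ is large enough that this is defined and $\mathcal A>0$); $S_h^\varphi(x)=\#\{n\le x:\varphi(n)=\varphi(n+h)\}$ with $n$ a positive integer. *)

(* Defs.v *)
From HB Require Import structures.
From mathcomp Require Import all_boot all_order all_algebra.
From mathcomp Require Import all_classical all_reals all_analysis.

Set Implicit Arguments.
Unset Strict Implicit.
Unset Printing Implicit Defensive.

Import Order.TTheory GRing.Theory Num.Theory.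

Local Open Scope ring_scope.

(* [ln] is total, with value 0 on nonpositive arguments, so the definitions
   below agree with the usual ones only for large [x]. *)
Definition iter_ln (R : realType) (j : nat) (x : R) : R := iter j (@ln R) x.

Definition calA (R : realType) (x : R) : R :=
  iter_ln 3 x + iter_ln 4 x - ln 2.

Definition G (R : realType) (x : R) : R := Num.sqrt (ln x * calA x).

(* The indices run over the integers 1 <= n <= floor x, that is, over the
   positive integers n <= x. *)
Definition Sphi (R : realType) (h : nat) (x : R) : nat :=
  count [pred n | totient n == totient (n + h)]
        (index_iota 1 (Num.truncn x).+1).

(* Main.v *)
(** Put V = sqrt (log x * log log x) and y = exp V; the count is shown to be
    O(x exp (- V / 80)), which suffices because V / G tends to infinity.
    Rankin's method and a Chebyshev bound show that few [n] have [n] or [n + h]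
    y-smooth, so let n = p m and n + h = p' m' with p, p' > y prime and
    (p - 1) phi(m) = (p' - 1) phi(m').  As h is odd, exactly one of m, m' is
    even, hence phi(m) / m <> phi(m') / m' and (m, m') determines n; this
    disposes of the [n] with m m' <= x exp (- V / 10).  Otherwise p p' exceeds
    x by a factor of at most about exp (V / 10).  Let d = gcd (p - 1, p' - 1).
    If d > exp (V / 5), then summing x / (p p') over primes congruent to 1
    modulo d saves a factor of about d.  If d is small and p <= p', say, then
    e = (p - 1) / d is large and divides phi(m').  Either the (log x)^2-smooth
    part of e is large, which is rare, or its rough part g is.  In that case g
    divides both p - 1 and phi(m'), and a number A <= 2 x has so few rough
    divisors g that the sum of their g^(-1/2) is bounded. *)

Require Import Defs.
From HB Require Import structures.
From mathcomp Require Import all_boot all_order all_algebra.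
From mathcomp Require Import all_classical all_reals all_analysis.
From mathcomp Require Import zify ring lra.
Import Order.TTheory GRing.Theory Num.Theory.
Local Open Scope ring_scope.

Set Implicit Arguments.
Unset Strict Implicit.
Unset Printing Implicit Defensive.

(** * Parity from equal ratios of [totient n] to [n] *)

Lemma prime_dvd_totient (P n : nat) : prime P -> (0 < n)%N ->
  (P %| totient n)%N ->
  (P %| n)%N \/ exists r, [/\ prime r, (r %| n)%N & (P %| r.-1)%N].
Proof.
move=> primeP n_gt0; rewrite totientE // big_seq.
pose K k := (P %| k)%N ->
  (P %| n)%N \/ exists r, [/\ prime r, (r %| n)%N & (P %| r.-1)%N].
rewrite -/(K _); apply: big_ind.
- by rewrite /K dvdn1 => /eqP P1; rewrite P1 in primeP.
- move=> a b Ka Kb; rewrite /K Euclid_dvdM // => /orP[/Ka|/Kb] //.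
- move=> r; rewrite mem_primes => /and3P[pr _ rn].
  rewrite /K Euclid_dvdM // => /orP[Pr|].
    by right; exists r.
  rewrite Euclid_dvdX // => /andP[]; rewrite dvdn_prime2 // => /eqP -> _.
  by left.
Qed.

Lemma totient_pdvd (P b : nat) : prime P -> (0 < b)%N -> (P %| b)%N ->
  exists j b1, [/\ b = (P ^ j.+1 * b1)%N, coprime P b1, (0 < b1)%N
    & totient b = (P ^ j * (P.-1 * totient b1))%N].
Proof.
move=> primeP b_gt0 Pb.
have [b1 cb1 eb] := pfactor_coprime primeP b_gt0.
have lb : (0 < logn P b)%N by rewrite logn_gt0 mem_primes primeP b_gt0.
exists (logn P b).-1, b1; split => //.
- by rewrite prednK // mulnC.
- by case: (posnP b1) eb => // ->; rewrite mul0n => b0; rewrite b0 in b_gt0.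
- rewrite {1}eb totient_coprime; last first.
    by rewrite coprime_sym coprimeXl.
  by rewrite totient_pfactor // mulnC mulnA [(P.-1 * _)%N]mulnC -mulnA.
Qed.

(* The largest prime dividing [a * b] must divide both [a] and [b], and can
   then be cancelled from the equality of ratios. *)
Lemma totient_ratio_odd (a b : nat) : (0 < a)%N -> (0 < b)%N ->
  (a * totient b = b * totient a)%N -> odd a = odd b.
Proof.
(* Cancelling [P ^ j] leaves [P] dividing [a * (P.-1 * totient b1)]. It is too large to divide
   [P.-1], and since it is coprime to [b1] it divides [totient b1] only if some prime factor of [b1]
   is 1 modulo [P], hence larger than the maximal [P]. *)
have key : forall P a b : nat, prime P -> (0 < a)%N -> (0 < b)%N ->
    (forall r, prime r -> (r %| a)%N || (r %| b)%N -> (r <= P)%N) ->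
    (a * totient b = b * totient a)%N -> (P %| b)%N -> (P %| a)%N.
  move=> {a b} P a b primeP a0 b0 Pmax e Pb.
  have [j [b1 [eb cb1 b10 tb]]] := totient_pdvd primeP b0 Pb.
  have P0 := prime_gt0 primeP; have P1 := prime_gt1 primeP.
  have : (P %| a * (P.-1 * totient b1))%N.
    have : (P ^ j * (a * (P.-1 * totient b1)) =
            P ^ j * (P * (b1 * totient a)))%N.
      by move: e; rewrite tb eb expnS; lia.
    move/eqP; rewrite eqn_mul2l expn_eq0 (gtn_eqF P0) /= => /eqP ->.
    exact: dvdn_mulr.
  rewrite !Euclid_dvdM // => /or3P[//||].
    by move=> /dvdn_leq; lia.
  case/prime_dvd_totient => // [|[r [pr rb1 Pr]]].
    by move: cb1; rewrite prime_coprime // => /negbTE ->.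
  have := Pmax r pr; rewrite eb dvdn_mull ?orbT // => /(_ isT) rP.
  have r1 := prime_gt1 pr.
  have : (P <= r.-1)%N by apply: dvdn_leq => //; lia.
  lia.
have [n] := ubnP (a + b); elim: n a b => // n IH a b abn a0 b0 e.
have [a1b1|] := boolP ((a == 1) && (b == 1)).
  by case/andP: a1b1 => /eqP-> /eqP->.
rewrite -muln_eq1 => ab1.
have ab0 : (0 < a * b)%N by rewrite muln_gt0 a0.
have {}ab1 : (1 < a * b)%N by rewrite ltn_neqAle eq_sym ab1.
have [P' Pab Pmax] : exists2 P, prime P /\ ((P %| a)%N || (P %| b)%N) &
    forall r, prime r -> (r %| a)%N || (r %| b)%N -> (r <= P)%N.
  exists (max_pdiv (a * b)).
    by split; [exact: max_pdiv_prime|rewrite -Euclid_dvdM ?max_pdiv_dvd ?max_pdiv_prime].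
  move=> r pr rab; apply: max_pdiv_max; rewrite mem_primes pr ab0 /=.
  by rewrite Euclid_dvdM.
case: Pab => primeP Pab.
have Pb : (P' %| b)%N.
  case/orP: Pab => // Pa; apply: (key P' b a) => // r pr; rewrite orbC; exact: Pmax.
have Pa : (P' %| a)%N by exact: (key P' a b).
have [i [a1 [ea _ a10 ta]]] := totient_pdvd primeP a0 Pa.
have [j [b1 [eb _ b10 tb]]] := totient_pdvd primeP b0 Pb.
(* If [P'] is 2, both numbers are even. Otherwise stripping the powers of the odd [P'] keeps both
   parities, and the equation passes to [a1] and [b1]. *)
have [P2|P2] := eqVneq P' 2.
  by move: Pa Pb; rewrite P2 !dvdn2 => /negbTE-> /negbTE->.
have oP : odd P' by case/even_prime: primeP P2 => [->|].
have ab1' : odd a1 = odd b1.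
  apply: IH => //.
    have := prime_gt1 primeP => P1.
    have : (a1 < a)%N by rewrite ea ltn_Pmull // -(exp1n i.+1) ltn_exp2r.
    have : (b1 <= b)%N by rewrite eb leq_pmull // expn_gt0 prime_gt0.
    by lia.
  move: e; rewrite ta tb {1}ea {1}eb !expnS => e.
  have := prime_gt1 primeP => P1.
  have : (P' * P' ^ i * P' ^ j * P'.-1 * (a1 * totient b1) =
      P' * P' ^ i * P' ^ j * P'.-1 * (b1 * totient a1))%N by lia.
  move/eqP; rewrite eqn_mul2l !muln_eq0 !expn_eq0 => /orP[|/eqP //]; lia.
by rewrite ea eb !oddM !oddX oP.
Qed.

(** * Chebyshev's bound in dyadic intervals *)

Lemma prod_primes_dvd (s : seq nat) (m : nat) : uniq s -> all prime s ->
  all (dvdn^~ m) s -> (\prod_(p <- s) p %| m)%N.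
Proof.
elim: s => [|p s IH] /=; first by rewrite big_nil.
case/andP=> ps us /andP[pp aps] /andP[pm asm].
rewrite big_cons Gauss_dvd ?pm ?IH // prime_coprime //.
apply/negP; rewrite big_seq; apply/negP.
elim/big_ind: _ => [|a b na nb|q qs].
- by rewrite dvdn1 neq_ltn prime_gt1 ?orbT.
- by rewrite Euclid_dvdM // negb_or na.
- have pq := allP aps _ qs; rewrite dvdn_prime2 //.
  by apply: contraNneq ps => ->.
Qed.

(** Such a prime divides the factorial of [n.*2] but not that of [n]. *)
Lemma prime_dvd_central_bin (n p : nat) : prime p -> (n < p <= n.*2)%N ->
  (p %| 'C(n.*2, n))%N.
Proof.
move=> pp /andP[np p2n].
have : (p %| (n.*2)`!)%N by rewrite dvdn_fact // prime_gt0.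
rewrite -(@bin_fact n.*2 n) -?addnn ?leq_addr // addnK.
have nf : ~~ (p %| n`!)%N.
  have : forall k, (k <= n)%N -> ~~ (p %| k`!)%N.
    elim=> [|k IH] kn; first by rewrite fact0 dvdn1 neq_ltn prime_gt1 ?orbT.
    rewrite factS Euclid_dvdM // negb_or IH ?(ltnW kn) // andbT.
    by rewrite gtnNdvd //; lia.
  exact.
by rewrite !Euclid_dvdM // (negbTE nf) !orbF.
Qed.

Lemma central_bin_le (n : nat) : ('C(n.*2, n) <= 2 ^ n.*2)%N.
Proof.
have n2 : (n < n.*2.+1)%N by rewrite -addnn ltnS leq_addr.
rewrite -[2%N]/(1 + 1)%N expnDn (bigD1 (Ordinal n2)) //= !exp1n !muln1.
exact: leq_addr.
Qed.

(** With n = 2^J, the primes in (n, 2n] all exceed n and their product divides the central binomial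
    coefficient, which is at most 2^(2n). Comparing exponents of 2 gives the bound. *)
Lemma count_prime_dyadic (J : nat) :
  (J * count prime (index_iota (2 ^ J).+1 (2 ^ J.+1).+1) <= 2 ^ J.+1)%N.
Proof.
set n := (2 ^ J)%N; set s := [seq p <- index_iota n.+1 (2 ^ J.+1).+1 | prime p].
have e2 : (2 ^ J.+1 = n.*2)%N by rewrite expnS mul2n.
have sP p : p \in s -> prime p /\ (n < p <= n.*2)%N.
  by rewrite mem_filter mem_index_iota e2 ltnS => /andP[].
rewrite -size_filter -/s.
have : (n ^ size s <= \prod_(p <- s) p)%N.
  have : all (leq n) s by apply/allP => p /sP; lia.
  elim: (s) => [|p r IH] /=; first by rewrite big_nil.
  by case/andP=> np /IH h; rewrite big_cons expnS leq_mul.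
have : (\prod_(p <- s) p <= 'C(n.*2, n))%N.
  apply: dvdn_leq; first by rewrite bin_gt0 -addnn leq_addr.
  apply: prod_primes_dvd.
  - by rewrite filter_uniq // iota_uniq.
  - exact: filter_all.
  - by apply/allP => p /sP[pp hp]; apply: prime_dvd_central_bin.
move=> /[swap] /leq_trans /[apply] /leq_trans /(_ (central_bin_le n)).
by rewrite /n -expnM leq_exp2l // e2.
Qed.

(** * Sums of completely multiplicative functions and of reciprocals *)

Section Sums.
Context {R : realType}.
Implicit Types (f : nat -> R) (P Q : pred nat).

Lemma sum_nat_sub (a K : nat) P Q f :
  (forall n, (a <= n < K)%N -> 0 <= f n) ->
  (forall n, (a <= n < K)%N -> P n -> Q n) ->
  \sum_(a <= n < K | P n) f n <= \sum_(a <= n < K | Q n) f n.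
Proof.
move=> f0 PQ; rewrite [leLHS]big_mkcond [leRHS]big_mkcond /=.
apply: ler_sum_nat => n hn; case: ifPn => Pn; first by rewrite PQ.
by case: ifPn => // _; apply: f0.
Qed.

(** This splits off one prime factor [q] in both Euler product inductions below: an [n] outside [P1]
    is charged to its cofactor [k], and after exchanging the sums each [k] receives at most one
    [n]. *)
Lemma sum_nat_dilate (q K : nat) P P1 Q f : (0 < q)%N ->
  (forall n, 0 <= f n) ->
  (forall n, (0 < n < K)%N -> P n -> P1 n \/ exists2 k, n = (q * k)%N & Q k) ->
  \sum_(1 <= n < K | P n) f n <=
    \sum_(1 <= n < K | P1 n) f n + \sum_(1 <= k < K | Q k) f (q * k)%N.
Proof.
move=> q0 f0 PP.
apply: (@le_trans _ _ (\sum_(1 <= n < K) ((if P1 n then f n else 0) +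
    \sum_(1 <= k < K | Q k) (if n == (q * k)%N then f n else 0)))).
  rewrite big_mkcond /=; apply: ler_sum_nat => n hn.
  have s0 : 0 <= \sum_(1 <= k < K | Q k) (if n == (q * k)%N then f n else 0).
    by apply: sumr_ge0 => k _; case: ifP.
  case: ifPn => Pn; last by rewrite addr_ge0 //; case: ifP.
  case: (PP n hn Pn) => [->|[k nk Qk]]; first by rewrite lerDl.
  apply: (@le_trans _ _ (\sum_(1 <= k < K | Q k) (if n == (q * k)%N then f n else 0))).
    rewrite big_mkcond (bigD1_seq k) ?iota_uniq //=; last first.
      by rewrite mem_index_iota; nia.
    rewrite Qk nk eqxx lerDl; apply: sumr_ge0 => j _.
    by case: ifP => // _; case: ifP.
  by rewrite lerDr; case: ifP.
rewrite big_split /= -big_mkcond lerD2l exchange_big /=.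
apply: ler_sum => k Qk; rewrite -big_mkcond /=.
rewrite (eq_bigr (fun=> f (q * k)%N)); last by move=> n /eqP ->.
rewrite big_const_seq iter_addr_0 -/(count_mem _ _) count_uniq_mem ?iota_uniq //.
by case: (_ \in _).
Qed.

(** The sum is at most the Euler product of (1 - f p)^(-1) over primes p <= y, and each factor is at
    most exp (f p / (1 - theta)). The induction on [y] adds one prime at a time and works with
    finite sums only. *)
Lemma sum_smooth_le f (theta : R) (K y : nat) : (forall n, 0 <= f n) ->
  f 1%N = 1 -> (forall a b, f (a * b)%N = f a * f b) ->
  theta < 1 -> (forall p, prime p -> f p <= theta) ->
  \sum_(1 <= n < K | [pred p | p <= y]%N.-nat n) f n <=
    expR ((1 - theta)^-1 * \sum_(1 <= p < y.+1 | prime p) f p).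
Proof.
move=> f0 f1 fM t1 ft; elim: y => [|y IH].
  rewrite [X in _ * X]big_geq // mulr0 expR0.
  apply: (@le_trans _ _ (\sum_(1 <= n < K | n == 1%N) f n)).
    apply: sum_nat_sub => // n /andP[n0 _].
    rewrite /pnat n0 /= => /allP sn; apply: contraT => n1.
    have n1' : (1 < n)%N by rewrite ltn_neqAle eq_sym n1.
    have /= := sn (pdiv n); rewrite inE leqn0 mem_primes pdiv_prime // n0 pdiv_dvd.
    by move=> /(_ isT) /eqP d0; have := pdiv_gt0 n; rewrite d0.
  have [K1|K1] := leqP K 1; first by rewrite big_geq.
  rewrite big_ltn_cond // eqxx f1 big_nat_cond big1 ?addr0 // => i.
  by case/andP=> /andP[i1 _] /eqP i1'; rewrite i1' in i1.
rewrite [X in _ * X]big_mkcond big_nat_recr //= -big_mkcond /=.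
have sub n : (0 < n)%N -> ~~ (prime y.+1 && (y.+1 %| n)%N) ->
    [pred p | p <= y.+1]%N.-nat n -> [pred p | p <= y]%N.-nat n.
  rewrite /pnat => -> /= ny /allP sn; apply/allP => p pn; move: (sn _ pn).
  rewrite !inE leq_eqVlt => /orP[/eqP py|//].
  by move: pn ny; rewrite mem_primes -py => /and3P[-> _ ->].
have [pr|npr] := boolP (prime y.+1); last first.
  rewrite addr0; apply: le_trans IH; apply: sum_nat_sub => // n /andP[n0 _].
  by apply: sub => //; rewrite (negbTE npr).
rewrite mulrDr expRD.
set S := \sum_(1 <= n < K | _) f n.
have S0 : 0 <= S by apply: sumr_ge0.
(* Writing [p] for [y.+1] and splitting off one factor [p] from the [n]
   divisible by [p] bounds [S] by the sum over [y]-smooth [n] plus [f p * S]. *)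
have HS : S <= \sum_(1 <= n < K | [pred p | p <= y]%N.-nat n) f n + f y.+1 * S.
  rewrite {2}/S mulr_sumr.
  under [X in _ <= _ + X]eq_bigr => n _ do rewrite -fM.
  apply: sum_nat_dilate => // n /andP[n0 _] sn.
  have [yn|yn] := boolP (y.+1 %| n)%N; [right|left].
    have en : n = (y.+1 * (n %/ y.+1))%N by rewrite mulnC divnK.
    by exists (n %/ y.+1)%N => //; move: sn; rewrite {1}en pnatM => /andP[].
  by apply: sub => //; rewrite (negbTE yn) andbF.
have fy := ft _ pr; have fy0 := f0 y.+1.
have e1 : S * (1 - f y.+1) <= expR ((1 - theta)^-1 *
    \sum_(1 <= p < y.+1 | prime p) f p).
  by apply: le_trans IH; lra.
have t0 : 0 < 1 - theta by lra.
(* With t = f p, convexity of exp reduces this to (1 - t) (1 + t / (1 - theta)) >= 1, which holds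
   for 0 <= t <= theta. *)
have e2 : 1 <= (1 - f y.+1) * expR ((1 - theta)^-1 * f y.+1).
  have h : 1 + (1 - theta)^-1 * f y.+1 <= expR ((1 - theta)^-1 * f y.+1).
    exact: expR_ge1Dx.
  apply: le_trans (ler_wpM2l _ h); last by lra.
  have i0 : (1 - theta)^-1 * (1 - theta) = 1 by rewrite mulVf // gt_eqF.
  have i1 : 0 < (1 - theta)^-1 by rewrite invr_gt0.
  have : 0 <= f y.+1 * ((1 - theta)^-1 * ((1 - f y.+1) - (1 - theta))).
    by rewrite !mulr_ge0 //; [exact: ltW|lra].
  by rewrite mulrBr i0; nra.
apply: (@le_trans _ _ (S * ((1 - f y.+1) * expR ((1 - theta)^-1 * f y.+1)))).
  by rewrite ler_peMr.
by rewrite mulrA ler_wpM2r // expR_ge0.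
Qed.

(** A number below 2^k has at most k prime factors with multiplicity, and each contributes a factor
    of at most 1 + c. The induction removes the least prime factor, which at least halves [A]. *)
Lemma sum_rough_divisors_le f (c : R) (K w k A : nat) :
  (forall n, 0 <= f n) -> f 1%N = 1 -> (forall a b, f (a * b)%N = f a * f b) ->
  0 <= c -> (forall p, (w < p)%N -> f p <= c) -> (0 < A < 2 ^ k)%N ->
  \sum_(1 <= g < K | (g %| A)%N && [pred p | w < p]%N.-nat g) f g <=
    (1 + c) ^+ k.
Proof.
move=> f0 f1 fM c0 fc; elim: k A => [|k IH] A; first by rewrite expn0; lia.
case/andP=> A0 Ak.
have [A1|A1] := leqP A 1.
  have -> : A = 1%N by lia.
  apply: (@le_trans _ _ (\sum_(1 <= n < K | n == 1%N) f n)).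
    by apply: sum_nat_sub => // n _; rewrite dvdn1 => /andP[].
  apply: (@le_trans _ _ 1); last by rewrite exprn_ege1 // lerDl.
  have [K1|K1] := leqP K 1; first by rewrite big_geq.
  rewrite big_ltn_cond // eqxx f1 big_nat_cond big1 ?addr0 // => i.
  by case/andP=> /andP[i1 _] /eqP i1'; rewrite i1' in i1.
set q := pdiv A; set A' := (A %/ q)%N.
have pq : prime q by rewrite pdiv_prime.
have eA : A = (q * A')%N by rewrite mulnC divnK // pdiv_dvd.
have A'0 : (0 < A')%N by move: A0; rewrite eA; case: (A') => //; rewrite muln0.
have A'k : (A' < 2 ^ k)%N.
  by move: Ak (prime_gt1 pq); rewrite expnS eA; nia.
have IHA := IH A'; rewrite A'0 A'k in IHA; have {}IHA := IHA isT.
set S := \sum_(1 <= n < K | _) f n in IHA.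
have S0 : 0 <= S by apply: sumr_ge0.
apply: (@le_trans _ _ (S + c * S)); last first.
  by rewrite exprS -{1}[S]mul1r -mulrDl ler_wpM2l // addr_ge0.
(* A prime [q <= w] divides no rough number, so in that case the rough divisors of [A] already
   divide [A']. *)
have [wq|wq] := ltnP w q; last first.
  apply: (@le_trans _ _ S); last by rewrite lerDl mulr_ge0.
  apply: sum_nat_sub => // g _ /andP[gA rg]; rewrite rg andbT.
  move: gA; rewrite eA Gauss_dvdr // coprime_sym prime_coprime //.
  apply/negP => qg; move: (rg); rewrite /pnat => /andP[g0 /allP /(_ q)].
  by rewrite mem_primes pq g0 qg inE ltnNge wq => /(_ isT).
apply: (@le_trans _ _ (S + \sum_(1 <= g < K | (g %| A')%N &&
    [pred p | w < p]%N.-nat g) f (q * g)%N)).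
  apply: sum_nat_dilate; rewrite ?prime_gt0 // => g /andP[g0 gK] /andP[gA rg].
  have [qg|qg] := boolP (q %| g)%N; [right|left].
    have eg : g = (q * (g %/ q))%N by rewrite mulnC divnK.
    exists (g %/ q)%N => //; apply/andP; split.
      by move: gA; rewrite {1}eg eA dvdn_pmul2l // prime_gt0.
    by move: rg; rewrite {1}eg pnatM => /andP[].
  rewrite rg andbT; move: gA; rewrite eA Gauss_dvdr //.
  by rewrite coprime_sym prime_coprime.
rewrite lerD2l mulr_sumr; apply: ler_sum => g _.
by rewrite fM ler_wpM2r // fc.
Qed.

Definition harm (n : nat) : R := \sum_(1 <= k < n.+1) k%:R^-1.

Lemma harm_ge0 n : 0 <= harm n.
Proof. by apply: sumr_ge0. Qed.

Lemma harm_le n : (0 < n)%N -> harm n <= 1 + ln n%:R.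
Proof.
elim: n => // -[|n] IH _; first by rewrite /harm big_nat1 invr1 ln1 addr0.
rewrite /harm big_nat_recr //= -/(harm n.+1).
apply: le_trans (_ : 1 + ln n.+1%:R + n.+2%:R^-1 <= _); first by rewrite lerD2r IH.
rewrite -addrA lerD2l.
have n2 : 0 < n.+2%:R :> R by rewrite ltr0n.
have n1 : 0 < n.+1%:R :> R by rewrite ltr0n.
have e : n.+1%:R / n.+2%:R = 1 + (- n.+2%:R^-1) :> R.
  by rewrite -[n.+2]addn1 natrD; field; rewrite gt_eqF //; lra.
have : ln (n.+1%:R / n.+2%:R : R) <= - n.+2%:R^-1.
  rewrite e; apply: le_ln1Dx; rewrite ltrN2 invf_lt1 // ltr1n //.
rewrite ln_div ?posrE //; move: (ln _) (ln _) (_^-1) => a b c; lra.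
Qed.

Lemma sum_inv_sq_le (D Y : nat) : (0 < D)%N ->
  \sum_(1 <= k < Y.+1 | (D < k)%N) (k%:R ^+ 2)^-1 <= D%:R^-1 :> R.
Proof.
move=> D0.
have [YD|] := leqP Y D.
  rewrite big_nat_cond big1 ?invr_ge0 // => k /andP[]; lia.
(* The sharper bound telescopes, since 1/k^2 <= 1/(k-1) - 1/k. *)
move=> DY; apply: (@le_trans _ _ (D%:R^-1 - Y%:R^-1)); last first.
  by rewrite lerBlDr lerDl invr_ge0.
elim: Y DY => // Y IH; rewrite ltnS => DY.
rewrite big_mkcond big_nat_recr //= -big_mkcond ltnS DY /=.
have step : ((Y.+1%:R) ^+ 2)^-1 <= Y%:R^-1 - Y.+1%:R^-1 :> R.
  have Y0 : 0 < Y%:R :> R by rewrite ltr0n; lia.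
  have -> : Y%:R^-1 - Y.+1%:R^-1 = (Y%:R * Y.+1%:R)^-1 :> R.
    rewrite -addn1 natrD; field; rewrite !gt_eqF //=; lra.
  rewrite lef_pV2 ?posrE ?mulr_gt0 ?exprn_gt0 ?ltr0n //; last by lia.
  by rewrite expr2 ler_pM2r ?ltr0n // ler_nat.
move: DY; rewrite leq_eqVlt => /orP[/eqP DY|/IH h]; last first.
  by apply: le_trans (lerD h step) _; rewrite addrA subrK.
rewrite big_nat_cond big1; last by move=> k /andP[]; lia.
by rewrite add0r DY.
Qed.

(** For j >= 1 the interval (2^j, 2^(j+1)] holds at most 2^(j+1) / j primes, each with reciprocal
    below 2^(-j), so it contributes at most 2 / j. The interval for j = 0 contributes at most 1. *)
Lemma sum_inv_primes_le (J : nat) :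
  \sum_(1 <= p < (2 ^ J).+1 | prime p) p%:R^-1 <= 1 + 2 * harm J.-1 :> R.
Proof.
elim: J => [|J IH].
  by rewrite big_mkcond big_nat1 /= addr_ge0 // mulr_ge0 // harm_ge0.
rewrite (big_cat_nat _ (n := (2 ^ J).+1)) //=; last first.
  by rewrite ltnS leq_exp2l.
case: J IH => [|J] IH.
  rewrite big_mkcond big_nat1 /= add0r big_mkcond big_nat1 /=.
  apply: (@le_trans _ _ 1); first by rewrite invf_le1 ?ler1n.
  by rewrite lerDl mulr_ge0 // harm_ge0.
rewrite /= /harm big_nat_recr //= -/(harm J) mulrDr addrA.
apply: lerD => //.
set n := (2 ^ J.+1)%N.
have n0 : 0 < n%:R :> R by rewrite ltr0n expn_gt0.
apply: (@le_trans _ _ (\sum_(n.+1 <= p < (2 ^ J.+2).+1 | prime p) n%:R^-1)).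
  rewrite big_nat_cond [leRHS]big_nat_cond; apply: ler_sum => p.
  case/andP=> /andP[np _] _; have p0 : (0 < p)%N by lia.
  by rewrite lef_pV2 ?posrE // ?ltr0n // ler_nat ltnW.
rewrite big_const_seq iter_addr_0 -[_ *+ count _ _]mulr_natl.
rewrite ler_pdivrMr // mulrAC ler_pdivlMr ?ltr0n //.
by rewrite -!natrM ler_nat mulnC mulnC -expnS (leq_trans _ (count_prime_dyadic _)) // mulnC.
Qed.

End Sums.

(** * Counting integers up to [X]: union bounds and residue classes *)

Section Counting.
Context {R : realType}.
Implicit Types (P Q : nat -> Prop) (X : nat).

Definition cnt X P : R := \sum_(1 <= n < X.+1 | `[< P n >]) 1.

Lemma cntE X P : cnt X P = (count (fun n => `[< P n >]) (index_iota 1 X.+1))%:R.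
Proof. by rewrite /cnt big_const_seq iter_addr_0. Qed.

Lemma cnt_le X P Q : (forall n, (0 < n <= X)%N -> P n -> Q n) ->
  cnt X P <= cnt X Q.
Proof.
move=> PQ; apply: sum_nat_sub => // n hn /asboolP Pn.
by apply/asboolP; apply: PQ.
Qed.

Lemma cnt_or X P Q : cnt X (fun n => P n \/ Q n) <= cnt X P + cnt X Q.
Proof.
rewrite /cnt big_mkcond [X in _ <= X + _]big_mkcond.
rewrite [X in _ <= _ + X]big_mkcond -big_split /=; apply: ler_sum => n _.
case: asboolP => [PQ|_]; last by rewrite addr_ge0 //; case: ifP.
case: asboolP => Pn; first by rewrite lerDl; case: ifP.
by case: asboolP => Qn; [rewrite add0r|case: PQ].
Qed.

Lemma cnt_bigU X K (I : pred nat) P (Q : nat -> nat -> Prop) :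
  (forall n, (0 < n <= X)%N -> P n ->
    exists i, [/\ (0 < i < K)%N, I i & Q i n]) ->
  cnt X P <= \sum_(1 <= i < K | I i) cnt X (Q i).
Proof.
move=> PQ; rewrite /cnt.
under [leRHS]eq_bigr => i _ do rewrite big_mkcond.
rewrite exchange_big big_mkcond /=; apply: ler_sum_nat => n hn.
have s0 : 0 <= \sum_(1 <= i < K | I i) (if `[< Q i n >] then 1 else 0 : R).
  by apply: sumr_ge0 => i _; case: ifP.
case: asboolP => // /(PQ _ hn)[i [hi Ii Qin]].
rewrite big_mkcond (bigD1_seq i) ?iota_uniq //=; last by rewrite mem_index_iota.
rewrite Ii (asboolT Qin) lerDl; apply: sumr_ge0 => j _.
by case: ifP => // _; case: ifP.
Qed.

Lemma cnt_shift X Y h P : (X + h <= Y)%N ->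
  cnt X (fun n => P (n + h)%N) <= cnt Y P.
Proof.
move=> XY; apply: (@le_trans _ _ (\sum_(h.+1 <= n < (X + h).+1 | `[< P n >]) 1)).
  rewrite -[h.+1]add1n big_addn.
  by rewrite (_ : ((X + h).+1 - h)%N = X.+1) // -addSn addnK.
rewrite /cnt (big_cat_nat _ (n := h.+1) (p := Y.+1)) //=; last by lia.
rewrite (big_cat_nat _ (m := h.+1) (n := (X + h).+1) (p := Y.+1)) //=; last by lia.
by rewrite addrCA lerDl addr_ge0 // sumr_ge0.
Qed.

(** Division by [k] is injective on a single residue class, so there are at most X/k + 1 elements.
    As soon as one exists, k <= C, which turns the extra 1 into C/k. *)
Lemma cnt_sep X k (C : R) P : (0 < k)%N ->
  0 <= C ->
  (forall n1 n2, P n1 -> P n2 -> n1 = n2 %[mod k]) ->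
  (forall n, (0 < n <= X)%N -> P n -> k%:R <= C) ->
  cnt X P <= (X%:R + C) / k%:R.
Proof.
move=> k0 C0 sepP kC; have k0' : 0 < k%:R :> R by rewrite ltr0n.
rewrite cntE -size_filter.
set s := [seq n <- _ | _].
have sP n : n \in s -> P n /\ (0 < n <= X)%N.
  by rewrite mem_filter mem_index_iota ltnS => /andP[/asboolP].
have [->|s0] := eqVneq (size s) 0%N.
  by rewrite divr_ge0 ?addr_ge0.
have {}kC : k%:R <= C.
  case: s s0 sP => // a s _ /(_ a); rewrite mem_head => /(_ isT) [Pa ha].
  exact: kC ha Pa.
have : (size [seq (n %/ k)%N | n <- s] <= size (iota 0 (X %/ k).+1))%N.
  apply: uniq_leq_size.
    rewrite map_inj_in_uniq ?filter_uniq ?iota_uniq // => a b /sP[Pa _] /sP[Pb _].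
    by move=> e; rewrite (divn_eq a k) (divn_eq b k) e (sepP _ _ Pa Pb).
  move=> _ /mapP[n /sP[_ /andP[_ nX]] ->].
  by rewrite mem_iota /= add0n ltnS leq_div2r.
rewrite size_map size_iota => szs.
rewrite ler_pdivlMr //; apply: (@le_trans _ _ ((X %/ k).+1%:R * k%:R)).
  by rewrite ler_pM2r // ler_nat.
rewrite -addn1 natrD mulrDl mul1r lerD // -natrM ler_nat.
exact: leq_trunc_div.
Qed.

Lemma cnt_crt X a b c c' (C : R) : (0 < a)%N -> (0 < b)%N -> coprime a b ->
  (a * b)%:R <= C ->
  cnt X (fun n => (a %| n + c)%N /\ (b %| n + c')%N) <= (X%:R + C) / (a * b)%:R.
Proof.
move=> a0 b0 ab abC; apply: cnt_sep => //.
- by rewrite muln_gt0 a0.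
- exact: le_trans abC.
move=> n1 n2 [an1 bn1] [an2 bn2]; apply/eqP.
rewrite chinese_remainder //; apply/andP; split.
  by rewrite -(eqn_modDr c) -!/(_ %% _)%N (eqP an1) (eqP an2).
by rewrite -(eqn_modDr c') (eqP bn1) (eqP bn2).
Qed.

End Counting.

(** * Anatomy of a solution: large primes, cofactors and exceptional events *)

(** Since [pnat] rejects 0, smooth and rough numbers are positive. *)
Definition smooth (y : nat) : pred nat := [pred p | p <= y]%N.-nat.
Definition rough (w : nat) : pred nat := [pred p | w < p]%N.-nat.

(** A number that is not smooth has a prime factor p > y; as p^2 does not divide it, p is coprime to
    the cofactor and [totient] splits. *)
Lemma extract_large_prime (y n : nat) : (0 < n)%N -> ~~ smooth y n ->
  ~ (exists2 q, (y < q)%N & (q ^ 2 %| n)%N) ->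
  exists p m, [/\ prime p, (y < p)%N, n = (p * m)%N, (0 < m)%N &
    totient n = (p.-1 * totient m)%N].
Proof.
move=> n0; rewrite /smooth /pnat n0 /= => /allPn[p pn]; rewrite inE -ltnNge => yp nsq.
move: pn; rewrite mem_primes => /and3P[pp _ pn].
have en : n = (p * (n %/ p))%N by rewrite mulnC divnK.
have m0 : (0 < n %/ p)%N by rewrite divn_gt0 ?prime_gt0 // dvdn_leq.
exists p, (n %/ p)%N; split => //.
rewrite {1}en totient_coprime; first by rewrite totient_prime.
rewrite prime_coprime //; apply/negP => pm; apply: nsq; exists p => //.
by rewrite en expnS expn1 dvdn_pmul2l ?prime_gt0.
Qed.

(* The rows of [(m, m'; phi m, phi m')] are independent because exactly one
   of [m], [m'] is even. *)
Lemma cofactors_determine (m m' h p q p' q' : nat) : (0 < m)%N -> (0 < m')%N ->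
  odd m != odd m' ->
  (p * m + h = p' * m')%N -> (q * m + h = q' * m')%N ->
  (p.-1 * totient m = p'.-1 * totient m')%N ->
  (q.-1 * totient m = q'.-1 * totient m')%N ->
  (0 < p)%N -> (0 < q)%N -> (0 < p')%N -> (0 < q')%N -> p = q.
Proof.
wlog pq : p q p' q' / (p <= q)%N.
  move=> W m0 m'0 om e1 e2 t1 t2 p0 q0 p'0 q'0.
  have [pq|/ltnW qp] := leqP p q; first exact: (W p q p' q').
  by symmetry; apply: (W q p q' p').
move=> m0 m'0 om e1 e2 t1 t2 p0 q0 p'0 q'0.
apply/eqP; rewrite eqn_leq pq /= leqNgt; apply/negP => ltpq.
have pq' : (p' <= q')%N.
  by rewrite -(leq_pmul2r m'0) -e1 -e2 leq_add2r leq_mul2r pq orbT.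
have E1 : ((q - p) * m = (q' - p') * m')%N.
  rewrite !mulnBl; lia.
(* Together with [E1], this difference of the two solutions makes m : m' equal to phi(m) : phi(m'),
   which forces equal parities. *)
have E2 : ((q - p) * totient m = (q' - p') * totient m')%N.
  have -> : (q - p = q.-1 - p.-1)%N by lia.
  have -> : (q' - p' = q'.-1 - p'.-1)%N by lia.
  by rewrite !mulnBl t1 t2.
have d0 : (0 < q - p)%N by lia.
have d'0 : (0 < q' - p')%N.
  by case: (q' - p')%N E1 => //; rewrite mul0n => /eqP; rewrite muln_eq0; lia.
suff : odd m = odd m' by apply/eqP.
apply: totient_ratio_odd => //.
apply/eqP; rewrite -(eqn_pmul2l d0) -(eqn_pmul2l d'0); apply/eqP.
transitivity (((q - p) * m) * ((q' - p') * totient m'))%N; first by lia.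
by rewrite -E2 E1; lia.
Qed.

Lemma totient_le (n : nat) : (totient n <= n)%N.
Proof.
rewrite totient_count_coprime.
apply: (@leq_trans (\sum_(0 <= d < n) 1)%N); first by apply: leq_sum => d _; exact: leq_b1.
by rewrite sum_nat_const_nat subn0 muln1.
Qed.

Definition large_square (y N : nat) : Prop :=
  exists2 q, (y < q)%N & (q ^ 2 %| N)%N.

(** Of the primality of p and p' only oddness is recorded; for odd [h] it gives m and m' opposite
    parities. *)
Definition small_cofactors (R : realType) (Q : R) (h n : nat) : Prop :=
  exists m m' p p', [/\ (0 < m)%N /\ (0 < m')%N,
    (m * m')%:R <= Q, odd p && odd p', n = (p * m)%N /\ (n + h = p' * m')%N &
    (p.-1 * totient m = p'.-1 * totient m')%N].

(* The primes are [p = d k + 1] and [p' = d l + 1], and [d] is the gcd of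
   [p - 1] and [p' - 1]. *)
Definition large_gcd (R : realType) (X D : nat) (Q : R) (h n : nat) : Prop :=
  exists d k l, [/\ (D < d)%N, (0 < k)%N /\ (0 < l)%N,
    coprime (d * k).+1 (d * l).+1,
    ((d * k).+1 %| n)%N /\ ((d * l).+1 %| n + h)%N &
    ((d * k).+1 * (d * l).+1)%:R * Q <= 2 * X%:R ^+ 2].

(** The prime is f k + 1, with f the smooth part of (p - 1) / gcd (p - 1, p' - 1). *)
Definition smooth_shift (R : realType) (w : nat) (S : R) (N : nat) : Prop :=
  exists f m k, [/\ smooth w f, S < f%:R, (0 < k)%N, (0 < m)%N &
    N = (m * (f * k).+1)%N].

(** The smaller prime is g k + 1, and m is the cofactor of the larger one. The lower bound on g
    comes from p - 1 = d f g with d <= D and f <= S. *)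
Definition rough_divisor (R : realType) (Y y w D : nat) (S : R)
    (N1 N2 : nat) : Prop :=
  exists m g k, [/\ rough w g /\ y%:R <= g%:R * (S * D%:R),
    (g %| totient m)%N, (0 < k)%N /\ (0 < m)%N,
    coprime (g * k).+1 m /\ ((g * k).+1 * m <= Y)%N &
    ((g * k).+1 %| N1)%N /\ (m %| N2)%N].

(** Dividing the totient equation by d leaves e phi(m) = e' phi(m') with e and e' coprime, so e
    divides phi(m'). Write e = f g with f smooth and g rough: either f > S, or g is large because p
    - 1 = d f g >= y. *)
Lemma large_gcd_or_sieve (R : realType) (Y y w D : nat) (S : R)
  (N1 N2 p p' m m' : nat) :
  0 <= S ->
  prime p -> prime p' -> (y < p)%N -> (2 < p)%N -> (p <= p')%N ->
  (0 < m)%N -> (0 < m')%N ->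
  N1 = (p * m)%N -> N2 = (p' * m')%N -> coprime p N2 -> (N2 <= Y)%N ->
  (p.-1 * totient m = p'.-1 * totient m')%N ->
  (gcdn p.-1 p'.-1 <= D)%N ->
  smooth_shift w S N1 \/ rough_divisor Y y w D S N1 N2.
Proof.
move=> S0 pp pp' yp p2 pp'le m0 m'0 eN1 eN2 cop N2Y et.
set d := gcdn _ _ => dD.
have d0 : (0 < d)%N by rewrite gcdn_gt0; lia.
set e := (p.-1 %/ d)%N; set e' := (p'.-1 %/ d)%N.
have ee : p.-1 = (d * e)%N by rewrite mulnC divnK // dvdn_gcdl.
have ee' : p'.-1 = (d * e')%N by rewrite mulnC divnK // dvdn_gcdr.
have cee' : coprime e e'.
  rewrite /coprime -(eqn_pmul2l d0) muln1; apply/eqP.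
  by rewrite muln_gcdr -ee -ee'.
have e0 : (0 < e)%N by move: ee; case: (e) => //; rewrite muln0; lia.
have edvd : (e %| totient m')%N.
  rewrite -(Gauss_dvdr _ cee').
  have : (d * (e * totient m) = d * (e' * totient m'))%N.
    by rewrite !mulnA -ee -ee' et.
  by move/eqP; rewrite eqn_pmul2l // => /eqP <-; exact: dvdn_mulr.
set f := (e`_[pred p | p <= w])%N; set g := (e`_[pred p | p <= w]^')%N.
have efg : e = (f * g)%N by rewrite partnC.
have f0 : (0 < f)%N by exact: part_gt0.
have g0 : (0 < g)%N by exact: part_gt0.
have sf : smooth w f by exact: part_pnat.
have rg : rough w g.
  have -> : rough w g = ([pred p | p <= w]^').-nat%N g.
    by apply: eq_pnat => q; rewrite !inE /= ltnNge.
  exact: part_pnat.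
have pE : p = (p.-1).+1 by rewrite prednK // prime_gt0.
have [Sf|fS] := ltP S f%:R.
  left; exists f, m, (d * g)%N; split => //; first by rewrite muln_gt0 d0.
  by rewrite eN1 {1}pE ee efg mulnC; congr (_ * _.+1)%N; lia.
right; exists m', g, (d * f)%N.
have pgk : p = (g * (d * f)).+1 by rewrite {1}pE ee efg; congr _.+1; lia.
rewrite -pgk; split.
- split => //.
  have ep : (y <= d * (f * g))%N by rewrite -efg -ee; lia.
  apply: (@le_trans _ _ (d * (f * g))%:R); first by rewrite ler_nat.
  rewrite !natrM mulrCA [f%:R * _]mulrC -mulrA; rewrite mulrCA.
  rewrite ler_wpM2l // [S * _]mulrC ler_pM // ?ler_nat //.
- by apply: dvdn_trans edvd; rewrite efg dvdn_mull.
- by rewrite muln_gt0 d0.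
- split; first by move: cop; rewrite eN2 coprimeMr => /andP[].
  by apply: leq_trans N2Y; rewrite eN2 leq_mul2r pp'le orbT.
- by rewrite eN1 eN2 dvdn_mulr // dvdn_mull.
Qed.

(** * Bounds for each exceptional event, with indices up to 2 X because n + h <= 2 X *)

Section Finitary.
Context {R : realType} (X : nat) (X0 : (0 < X)%N).
Local Notation Y := X.*2.
Local Notation H := (harm Y : R).

Let Y2 : Y%:R = 2 * X%:R :> R.
Proof. by rewrite -mul2n natrM. Qed.

Let invM (a b : nat) : (a * b)%:R^-1 = a%:R^-1 * b%:R^-1 :> R.
Proof. by rewrite natrM invfM. Qed.

Lemma cnt_square (y c : nat) : (0 < y)%N -> (c <= X)%N ->
  cnt X (fun n => large_square y (n + c)) <=
    3 * X%:R / y%:R :> R.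
Proof.
move=> y0 cX.
apply: (@le_trans _ _ (\sum_(1 <= q < Y.+1 | (y < q)%N)
    cnt X (fun n => (q ^ 2 %| n + c)%N))).
  apply: cnt_bigU => n /andP[n0 nX] [q yq qn].
  have qle : (q ^ 2 <= n + c)%N by apply: dvdn_leq => //; lia.
  exists q; split => //; nia.
apply: (@le_trans _ _ (\sum_(1 <= q < Y.+1 | (y < q)%N)
    (3 * X%:R) * (q%:R ^+ 2)^-1)).
  apply: ler_sum => q yq; rewrite -natrX.
  have -> : 3 * X%:R = X%:R + 2 * X%:R :> R by ring.
  apply: cnt_sep.
  - by rewrite expn_gt0; lia.
  - by rewrite mulr_ge0.
  - by move=> a b /= qa qb; apply/eqP; rewrite -(eqn_modDr c) (eqP qa) (eqP qb).
  - move=> n /andP[n0 nX] qn; rewrite -natrM ler_nat.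
    have : (q ^ 2 <= n + c)%N by apply: dvdn_leq => //; lia.
    lia.
by rewrite -mulr_sumr ler_wpM2l ?mulr_ge0 // sum_inv_sq_le.
Qed.

(** Each pair (m, m') determines n, and the indicator of m m' <= Q is at most Q / (m m'), whose
    double sum is at most Q H^2. *)
Lemma cnt_small_cofactors (h : nat) (Q : R) : 0 <= Q -> (h <= X)%N ->
  odd h ->
  cnt X (small_cofactors Q h) <= 2 * Q * H ^+ 2.
Proof.
move=> Q0 hX oh.
pose B m m' n := exists p p', [/\ (0 < m)%N /\ (0 < m')%N,
      (m * m')%:R <= Q, odd p && odd p', n = (p * m)%N /\ (n + h = p' * m')%N &
      (p.-1 * totient m = p'.-1 * totient m')%N].
apply: (@le_trans _ _ (\sum_(1 <= m < Y.+1) \sum_(1 <= m' < Y.+1)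
    cnt X (B m m'))).
  apply: (@le_trans _ _ (\sum_(1 <= m < Y.+1)
      cnt X (fun n => exists2 m', (0 < m' < Y.+1)%N & B m m' n))).
    apply: cnt_bigU => n /andP[n0 nX] [m [m' [p [p' E]]]].
    have [[m0 m'0] _ /andP[op op'] [e1 e2] _] := E.
    have p0 := odd_gt0 op; have p'0 := odd_gt0 op'.
    exists m; split => //; first by nia.
    by exists m'; [nia|exists p, p'].
  apply: ler_sum => m _; apply: cnt_bigU => n _ [m' hm' E].
  by exists m'.
apply: (@le_trans _ _ (\sum_(1 <= m < Y.+1) \sum_(1 <= m' < Y.+1)
    2 * Q * (m%:R^-1 * m'%:R^-1))).
  apply: ler_sum_nat => m hm; apply: ler_sum_nat => m' hm'.
  have mm0 : 0 < (m * m')%:R :> R by rewrite ltr0n muln_gt0; lia.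
  have [mQ|Qm] := leP (m * m')%:R Q; last first.
    apply: (@le_trans _ _ 0); last by rewrite !mulr_ge0 ?invr_ge0.
    rewrite /cnt big1 // => n /asboolP[p [p' [_ mQ _ _ _]]].
    by move: mQ; rewrite leNgt Qm.
  (* At most one n occurs, so the modulus X may be used; it yields the bound 2. *)
  apply: (@le_trans _ _ ((X%:R + X%:R) / X%:R)).
    apply: cnt_sep => // a b [p [p' [[m0 m'0] _ /andP[op op'] [e1 e2] e3]]].
    case=> [q [q' [_ _ /andP[oq oq'] [f1 f2] f3]]].
    suff -> : a = b by [].
    rewrite e1 f1; congr muln.
    apply: (@cofactors_determine m m' h p q p' q') => //; try exact: odd_gt0.
    - have : odd (p * m + h) = odd (p' * m') by rewrite -e1 e2.
      by rewrite oddD !oddM oh op op' /=; case: (odd m); case: (odd m').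
    - by rewrite -e1.
    - by rewrite -f1.
  have X0' : 0 < X%:R :> R by rewrite ltr0n.
  have -> : (X%:R + X%:R) / X%:R = 2 :> R by field; rewrite gt_eqF.
  by rewrite -mulrA ler_peMr // -invM ler_pdivlMr // mul1r.
under eq_bigr => m _ do under eq_bigr => m' _ do rewrite mulrA.
under eq_bigr => m _ do rewrite -mulr_sumr -/H.
by rewrite -mulr_suml -mulr_sumr -/H -mulrA -expr2.
Qed.

(** For fixed d, k, l the two coprime moduli d k + 1 and d l + 1 leave at most (X + C) / (d^2 k l)
    values of n. Summing over k and l costs H^2, while summing 1/d^2 over d > D saves a factor D. *)
Lemma cnt_large_gcd (h D : nat) (Q : R) : (0 < D)%N -> (h <= X)%N ->
  0 < Q <= X%:R ->
  cnt X (large_gcd X D Q h) <=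
  3 * X%:R ^+ 2 / Q / D%:R * H ^+ 2.
Proof.
move=> D0 hX /andP[Q0 QX].
set C := 2 * X%:R ^+ 2 / Q.
have C0 : 0 <= C by rewrite !mulr_ge0 // ?exprn_ge0 // invr_ge0 ltW.
pose B d k l n := [/\ (D < d)%N, (0 < k)%N /\ (0 < l)%N,
     coprime (d * k).+1 (d * l).+1,
     ((d * k).+1 %| n)%N /\ ((d * l).+1 %| n + h)%N &
     ((d * k).+1 * (d * l).+1)%:R * Q <= 2 * X%:R ^+ 2].
have range n d k l : (0 < n <= X)%N -> B d k l n ->
    [/\ (0 < d < Y.+1)%N, (0 < k < Y.+1)%N & (0 < l < Y.+1)%N].
  move=> /andP[n0 nX] [Dd [k0 l0] _ [kn ln] _].
  have k1 : ((d * k).+1 <= n)%N by apply: dvdn_leq.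
  have l1 : ((d * l).+1 <= n + h)%N by apply: dvdn_leq => //; lia.
  by split; nia.
apply: (@le_trans _ _ (\sum_(1 <= d < Y.+1 | (D < d)%N) \sum_(1 <= k < Y.+1)
    \sum_(1 <= l < Y.+1) cnt X (B d k l))).
  apply: (@le_trans _ _ (\sum_(1 <= d < Y.+1 | (D < d)%N)
     cnt X (fun n => exists k l, B d k l n))).
    apply: cnt_bigU => n hn [d [k [l E]]]; have [hd _ _] := range _ _ _ _ hn E.
    by exists d; split => //; [case: E|exists k, l].
  apply: ler_sum => d _.
  apply: (@le_trans _ _ (\sum_(1 <= k < Y.+1)
     cnt X (fun n => exists l, B d k l n))).
    apply: cnt_bigU => n hn [k [l E]]; have [_ hk _] := range _ _ _ _ hn E.
    by exists k; split => //; exists l.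
  apply: ler_sum => k _; apply: cnt_bigU => n hn [l E].
  by have [_ _ hl] := range _ _ _ _ hn E; exists l.
have XC : X%:R + C <= 3 * X%:R ^+ 2 / Q.
  rewrite /C ler_pdivlMr // mulrDl divfK ?gt_eqF //.
  have : X%:R * Q <= X%:R * X%:R :> R by rewrite ler_wpM2l.
  by rewrite expr2; lra.
set E := 3 * X%:R ^+ 2 / Q in XC *.
have E0 : 0 <= E by apply: le_trans XC; rewrite addr_ge0.
clearbody E.
apply: (@le_trans _ _ (\sum_(1 <= d < Y.+1 | (D < d)%N) \sum_(1 <= k < Y.+1)
    \sum_(1 <= l < Y.+1) E * (d%:R ^+ 2)^-1 * (k%:R^-1 * l%:R^-1))).
  rewrite big_nat_cond [leRHS]big_nat_cond; apply: ler_sum => d /andP[hd Dd].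
  apply: ler_sum_nat => k hk; apply: ler_sum_nat => l hl.
  have R0 : 0 <= E * (d%:R ^+ 2)^-1 * (k%:R^-1 * l%:R^-1).
    by rewrite !mulr_ge0 ?invr_ge0 ?exprn_ge0.
  have [Hc|Hc] := asboolP (coprime (d * k).+1 (d * l).+1 /\
      ((d * k).+1 * (d * l).+1)%:R * Q <= 2 * X%:R ^+ 2); last first.
    rewrite /cnt big1 // => n /asboolP[_ _ c _ c']; by case: Hc.
  case: Hc => cop le; rewrite -ler_pdivlMr // -/C in le.
  apply: (@le_trans _ _ ((X%:R + C) / ((d * k).+1 * (d * l).+1)%:R)).
    apply: le_trans (cnt_crt X 0 h _ _ cop le) => //.
    by apply: cnt_le => n _ [_ _ _ [a b] _]; rewrite addn0.
  rewrite -mulrA; apply: ler_pM => //; rewrite ?addr_ge0 ?invr_ge0 //.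
  rewrite -invM -natrX -invM lef_pV2 ?posrE ?ltr0n ?muln_gt0 ?expn_gt0; last first.
  - by lia.
  - by [].
  by rewrite ler_nat; nia.
under eq_bigr => d _ do under eq_bigr => k _ do
  (under eq_bigr => l _ do rewrite mulrA; rewrite -mulr_sumr -/H).
under eq_bigr => d _ do rewrite -mulr_suml -mulr_sumr -/H -mulrA.
rewrite -mulr_suml -mulr_sumr -expr2 ler_wpM2r ?exprn_ge0 ?harm_ge0 //.
by rewrite ler_wpM2l // sum_inv_sq_le.
Qed.

(** Since m (f k + 1) is m modulo m f, fixing f and m puts n in one residue class modulo f m,
    whatever k is. *)
Lemma cnt_smooth_shift (w c : nat) (S : R) : (c <= X)%N ->
  cnt X (fun n => smooth_shift w S (n + c)) <=
  3 * X%:R * H * \sum_(1 <= f < Y.+1 | smooth w f && (S < f%:R)) f%:R^-1.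
Proof.
move=> cX.
pose B f m n := (0 < m)%N /\ exists2 k, (0 < k)%N & (n + c = m * (f * k).+1)%N.
apply: (@le_trans _ _ (\sum_(1 <= f < Y.+1 | smooth w f && (S < f%:R))
    \sum_(1 <= m < Y.+1) cnt X (B f m))).
  apply: (@le_trans _ _ (\sum_(1 <= f < Y.+1 | smooth w f && (S < f%:R))
     cnt X (fun n => exists m, B f m n))).
    apply: cnt_bigU => n /andP[n0 nX] [f [m [k [sf Sf k0 m0 e]]]].
    exists f; split; [|by rewrite sf|by exists m; split => //; exists k].
    have f0 : (0 < f)%N by case/andP: sf.
    have fk : ((f * k).+1 <= n + c)%N by rewrite e leq_pmull.
    by have := leq_pmulr f k0; lia.
  apply: ler_sum => f _; apply: cnt_bigU => n /andP[n0 nX] [m E].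
  have [m0 [k k0 e]] := E.
  have mk : (m <= n + c)%N by rewrite e leq_pmulr.
  by exists m; split => //; lia.
apply: (@le_trans _ _ (\sum_(1 <= f < Y.+1 | smooth w f && (S < f%:R))
    \sum_(1 <= m < Y.+1) 3 * X%:R * (f%:R^-1 * m%:R^-1))).
  rewrite big_nat_cond [leRHS]big_nat_cond; apply: ler_sum => f /andP[hf _].
  apply: ler_sum_nat => m hm; rewrite -invM.
  have -> : 3 * X%:R = X%:R + 2 * X%:R :> R by ring.
  apply: cnt_sep.
  - by rewrite muln_gt0; lia.
  - by rewrite mulr_ge0.
  - move=> a b [_ [k _ ea]] [_ [l _ eb]].
    apply/eqP; rewrite -(eqn_modDr c) ea eb !mulnS !mulnA [(m * f)%N]mulnC.
    by rewrite -modnDmr modnMr -[X in _ == X]modnDmr modnMr.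
  - move=> n /andP[n0 nX] [m0 [k k0 e]]; rewrite -natrM ler_nat.
    have : (f * m <= n + c)%N.
      by rewrite e [(f * m)%N]mulnC leq_mul2l (leq_trans (leq_pmulr f k0)) ?orbT.
    by lia.
under eq_bigr => f _ do (under eq_bigr => m _ do rewrite mulrA; rewrite -mulr_sumr -/H).
by rewrite -mulr_suml -mulr_sumr mulrAC.
Qed.

(** For fixed m, g, k the Chinese remainder theorem leaves at most 3 X / (g k m) values of n. The
    sums over k and m cost a factor H each; the sum over g is [sig], taken at A = phi(m). *)
Lemma cnt_rough_divisor (y w c c' D : nat) (S sig : R) :
  (c <= X)%N -> (c' <= X)%N -> 0 <= sig ->
  (forall A, (0 < A <= Y)%N -> \sum_(1 <= g < Y.+1 | (g %| A)%N && rough w g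
      && (y%:R <= g%:R * (S * D%:R))) g%:R^-1 <= sig) ->
  cnt X (fun n => rough_divisor Y y w D S (n + c) (n + c')) <=
  3 * X%:R * H ^+ 2 * sig.
Proof.
move=> cX c'X sig0 Hsig.
pose B m g k n := [/\ rough w g /\ y%:R <= g%:R * (S * D%:R),
     (g %| totient m)%N, (0 < k)%N /\ (0 < m)%N,
     coprime (g * k).+1 m /\ ((g * k).+1 * m <= Y)%N &
     ((g * k).+1 %| n + c)%N /\ (m %| n + c')%N].
have range n m g k : B m g k n ->
    [/\ (0 < m < Y.+1)%N, (0 < g < Y.+1)%N & (0 < k < Y.+1)%N].
  move=> [[rg _] _ [k0 m0] [_ le] _].
  have g0 : (0 < g)%N by case/andP: rg.
  have m1 : (m <= (g * k).+1 * m)%N by rewrite leq_pmull.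
  have k1 : ((g * k).+1 <= (g * k).+1 * m)%N by rewrite leq_pmulr.
  have := leq_pmulr g k0; have := leq_pmull k g0.
  by split; lia.
pose G m g := (g %| totient m)%N && rough w g && (y%:R <= g%:R * (S * D%:R)).
apply: (@le_trans _ _ (\sum_(1 <= m < Y.+1) \sum_(1 <= g < Y.+1 | G m g)
    \sum_(1 <= k < Y.+1) cnt X (B m g k))).
  apply: (@le_trans _ _ (\sum_(1 <= m < Y.+1)
     cnt X (fun n => exists g k, B m g k n))).
    apply: cnt_bigU => n hn [m [g [k E]]]; have [hm _ _] := range _ _ _ _ E.
    by exists m; split => //; exists g, k.
  apply: ler_sum => m _.
  apply: (@le_trans _ _ (\sum_(1 <= g < Y.+1 | G m g)
     cnt X (fun n => exists k, B m g k n))).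
    apply: cnt_bigU => n hn [g [k E]]; have [_ hg _] := range _ _ _ _ E.
    exists g; split => //; last by exists k.
    by case: E => -[rg le] gm _ _ _; rewrite /G gm rg.
  apply: ler_sum => g _; apply: cnt_bigU => n hn [k E].
  by have [_ _ hk] := range _ _ _ _ E; exists k.
apply: (@le_trans _ _ (\sum_(1 <= m < Y.+1) \sum_(1 <= g < Y.+1 | G m g)
    \sum_(1 <= k < Y.+1) 3 * X%:R * m%:R^-1 * g%:R^-1 * k%:R^-1)).
  apply: ler_sum_nat => m hm.
  rewrite big_nat_cond [leRHS]big_nat_cond; apply: ler_sum => g /andP[hg _].
  apply: ler_sum_nat => k hk.
  have [[cop le]|Hc] := asboolP (coprime (g * k).+1 m /\ ((g * k).+1 * m <= Y)%N);
    last first.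
    rewrite /cnt big1 ?mulr_ge0 ?invr_ge0 // => n /asboolP[_ _ _ [a b] _].
    by case: Hc.
  apply: (@le_trans _ _ ((X%:R + Y%:R) / ((g * k).+1 * m)%:R)).
    have le' : ((g * k).+1 * m)%:R <= Y%:R :> R by rewrite ler_nat.
    apply: le_trans (cnt_crt X c c' _ _ cop le') => //; last by lia.
    by apply: cnt_le => n _ [].
  have -> : 3 * X%:R = X%:R + Y%:R :> R by rewrite Y2; ring.
  rewrite -!mulrA ler_wpM2l ?addr_ge0 // -!invM.
  rewrite lef_pV2 ?posrE ?ltr0n ?muln_gt0; [by rewrite ler_nat; nia|lia|lia].
under eq_bigr => m _ do under eq_bigr => g _ do rewrite -mulr_sumr -/H.
under eq_bigr => m _ do rewrite -mulr_suml -mulr_sumr.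
rewrite -mulr_suml.
apply: (@le_trans _ _ ((\sum_(1 <= m < Y.+1) 3 * X%:R * m%:R^-1 * sig) * H)).
  rewrite ler_wpM2r ?harm_ge0 //; apply: ler_sum_nat => m hm.
  rewrite ler_wpM2l ?mulr_ge0 ?invr_ge0 //.
  apply: Hsig; rewrite totient_gt0; apply/andP; split; first by lia.
  apply: (@leq_trans m); last by lia.
  exact: totient_le.
rewrite -mulr_suml -mulr_sumr -/H le_eqVlt; apply/orP; left; apply/eqP; ring.
Qed.

End Finitary.

(** * Every solution lies in one of the exceptional events *)

(** Writing [n + 0] gives both members of the pair the shape n + c of the counting bounds. *)
Lemma totient_shift_cover (R : realType) (X h y w D n : nat) (Q S : R) :
  odd h -> (h <= X)%N -> (h <= y)%N -> (1 < y)%N -> 0 <= S -> 0 < Q ->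
  (0 < n <= X)%N -> totient n = totient (n + h) ->
  (smooth y n \/ smooth y (n + h)) \/
  (large_square y (n + 0) \/ large_square y (n + h)) \/
  (small_cofactors Q h n \/ large_gcd X D Q h n) \/
  (smooth_shift w S (n + 0) \/ smooth_shift w S (n + h)) \/
  (rough_divisor X.*2 y w D S (n + 0) (n + h) \/
   rough_divisor X.*2 y w D S (n + h) (n + 0)).
Proof.
move=> oh hX hy y1 S0 Q0 /andP[n0 nX] et; rewrite addn0.
have h0 := odd_gt0 oh.
have [|s1] := boolP (smooth y n); first by left; left.
have [|s2] := boolP (smooth y (n + h)); first by left; right.
have [|q1] := pselect (large_square y n); first by right; left; left.
have [|q2] := pselect (large_square y (n + h)); first by right; left; right.
right; right.
have nh0 : (0 < n + h)%N by lia.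
have [p [m [pp yp en m0 tn]]] := extract_large_prime n0 s1 q1.
have [p' [m' [pp' yp' enh m'0 tnh]]] := extract_large_prime nh0 s2 q2.
have e : (p.-1 * totient m = p'.-1 * totient m')%N by rewrite -tn -tnh.
(* A common prime factor of n and n + h divides h, hence is at most y. *)
have ndvd r : prime r -> (y < r)%N -> (r %| n)%N -> (r %| n + h)%N -> False.
  move=> pr yr rn; rewrite dvdn_addr // => rh.
  by have := dvdn_leq h0 rh; lia.
have cop : coprime p (n + h).
  rewrite prime_coprime //; apply/negP; apply: ndvd => //.
  by rewrite en dvdn_mulr.
have cop' : coprime p' n.
  rewrite prime_coprime //; apply/negP => pn; apply: (ndvd p') => //.
  by rewrite enh dvdn_mulr.
have oddp r : prime r -> (y < r)%N -> odd r.
  by move=> pr yr; case: (even_prime pr) => [r2|//]; lia.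
have [mQ|Qm] := leP (m * m')%:R Q.
  left; left; exists m, m', p, p'; split => //.
  by rewrite !oddp.
set d := gcdn p.-1 p'.-1.
have [Dd|dD] := ltnP D d.
  left; right.
  have ed : p = (d * (p.-1 %/ d)).+1.
    by rewrite mulnC divnK ?dvdn_gcdl // prednK // prime_gt0.
  have ed' : p' = (d * (p'.-1 %/ d)).+1.
    by rewrite mulnC divnK ?dvdn_gcdr // prednK // prime_gt0.
  exists d, (p.-1 %/ d)%N, (p'.-1 %/ d)%N; rewrite -ed -ed'; split => //.
  - split; apply: contraTT isT; rewrite -eqn0Ngt => /eqP k0.
      by move: ed yp; rewrite k0 muln0; lia.
    by move: ed' yp'; rewrite k0 muln0; lia.
  - by move: cop; rewrite enh coprimeMr => /andP[].
  - by rewrite {1}en enh !dvdn_mulr.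
  (* Here Q < m m', and p p' m m' = n (n + h) <= 2 X^2. *)
  - apply: (@le_trans _ _ ((p * p')%:R * (m * m')%:R)).
      by rewrite ler_wpM2l // ltW.
    rewrite -natrX -!natrM ler_nat.
    have -> : (p * p' * (m * m') = n * (n + h))%N by rewrite enh {1}en; lia.
    by rewrite expnS expn1 mulnCA leq_mul //; lia.
have p2 : (2 < p)%N by lia.
have p'2 : (2 < p')%N by lia.
have [le|/ltnW le] := leqP p p'.
  have [|c|c] := large_gcd_or_sieve (Y := X.*2) (y := y) w (D := D) S0 pp pp' yp
    p2 le m0 m'0 en enh cop _ e dD; first by lia.
  - by right; left; left.
  - by right; right; left.
have dD' : (gcdn p'.-1 p.-1 <= D)%N by rewrite gcdnC.
have [|c|c] := large_gcd_or_sieve (Y := X.*2) (y := y) w (D := D) S0 pp' pp yp'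
    p'2 le m'0 m0 enh en cop' _ (esym e) dD'; first by lia.
- by right; left; right.
- by right; right; right.
Qed.

(** A union bound over the cover; merging the four symmetric pairs doubles their bounds. *)
Lemma cnt_totient_shift (R : realType) (X h y w D : nat) (Q S sig : R) :
  odd h -> (h <= X)%N -> (h <= y)%N -> (1 < y)%N -> (0 < D)%N -> 0 <= S ->
  0 < Q <= X%:R -> 0 <= sig ->
  (forall A, (0 < A <= X.*2)%N ->
    \sum_(1 <= g < X.*2.+1 | (g %| A)%N && rough w g
      && (y%:R <= g%:R * (S * D%:R))) g%:R^-1 <= sig) ->
  cnt X (fun n => totient n = totient (n + h)) <=
    2 * cnt X.*2 (smooth y)
    + 6 * X%:R / y%:R
    + 2 * Q * harm X.*2 ^+ 2
    + 3 * X%:R ^+ 2 / Q / D%:R * harm X.*2 ^+ 2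
    + 6 * X%:R * harm X.*2 *
      (\sum_(1 <= f < X.*2.+1 | smooth w f && (S < f%:R)) f%:R^-1)
    + 6 * X%:R * harm X.*2 ^+ 2 * sig.
Proof.
move=> oh hX hy y1 D0 S0 hQ sig0 Hsig.
have h0 := odd_gt0 oh; have X0 : (0 < X)%N by lia.
have [Q0 QX] := andP hQ.
apply: le_trans (cnt_le (fun n hn e => totient_shift_cover w D oh hX hy y1 S0 Q0 hn e)) _.
have hsplit (a b t : R) : a <= t -> b <= t -> a + b <= 2 * t by lra.
have X2 : (X + h <= X.*2)%N by lia.
have X1 : (X + 0 <= X.*2)%N by lia.
rewrite -!addrA; apply: le_trans (cnt_or _ _ _) _; apply: lerD.
  apply: le_trans (cnt_or _ _ _) _; apply: hsplit.
    apply: le_trans (cnt_shift (fun n => smooth y n) X1).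
    by apply: cnt_le => n _; rewrite addn0.
  exact: (cnt_shift (fun n => smooth y n)).
have six (a b : R) : 6 * a * b = 2 * (3 * a * b) by ring.
apply: le_trans (cnt_or _ _ _) _; apply: lerD.
  apply: le_trans (cnt_or _ _ _) _; rewrite six; apply: hsplit.
    by apply: cnt_square => //; lia.
  by apply: cnt_square => //; lia.
rewrite addrA; apply: le_trans (cnt_or _ _ _) _; apply: lerD.
  apply: le_trans (cnt_or _ _ _) _; apply: lerD.
    by apply: cnt_small_cofactors => //; exact: ltW.
  exact: cnt_large_gcd.
apply: le_trans (cnt_or _ _ _) _; apply: lerD.
  rewrite -mulrA six; apply: le_trans (cnt_or _ _ _) _; apply: hsplit.
    by rewrite mulrA; apply: cnt_smooth_shift.
  by rewrite mulrA; apply: cnt_smooth_shift.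
rewrite -mulrA six; apply: le_trans (cnt_or _ _ _) _; apply: hsplit.
  by rewrite mulrA; apply: cnt_rough_divisor.
by rewrite mulrA; apply: cnt_rough_divisor.
Qed.

(** * Rankin's method for smooth numbers and rough divisors *)

Section Rankin.
Context {R : realType}.

Let pw (s : R) (n : nat) : R := n%:R `^ s.

Let pw_ge0 s n : 0 <= pw s n. Proof. exact: powR_ge0. Qed.
Let pw1 s : pw s 1 = 1. Proof. by rewrite /pw powR1. Qed.
Let pwM s a b : pw s (a * b) = pw s a * pw s b.
Proof. by rewrite /pw natrM powRM. Qed.

Lemma ler_npowR (a b s : R) : 0 < a -> a <= b -> s <= 0 -> b `^ s <= a `^ s.
Proof.
move=> a0 ab s0; have b0 : 0 < b by apply: lt_le_trans ab.
have [r r0 ->] : exists2 r, 0 <= r & s = - r by exists (- s); rewrite ?oppr_ge0 ?opprK.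
rewrite !powRN lef_pV2 ?posrE ?powR_gt0 //.
by apply: ge0_ler_powR => //; rewrite nnegrE ltW.
Qed.

(** Supplies theta = 3/4 in the Euler product: p^(eta - 1) <= 2^(-1/2) for eta <= 1/2. *)
Lemma powR2_Nhalf_le : 2 `^ (- 2^-1) <= 3 / 4 :> R.
Proof.
have t0 : 0 <= 2 `^ (- 2^-1) :> R by exact: powR_ge0.
have t2 : 2 `^ (- 2^-1) * 2 `^ (- 2^-1) = 2^-1 :> R.
  rewrite -powRD; last by rewrite (gt_eqF (ltr0n _ 2)) implybT.
  by rewrite (_ : - 2^-1 - 2^-1 = - 1) ?powR_inv1 //; lra.
by nra.
Qed.

(** For p <= y one has p^(eta - 1) <= y^eta / p, and the reciprocals of the primes up to 2^J sum to
    at most 3 + 2 ln J. The factor 4 is 1 / (1 - 3/4). *)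
Lemma sum_smooth_pow_le (y J K : nat) (eta : R) : 0 <= eta <= 2^-1 ->
  (0 < J)%N -> (y <= 2 ^ J)%N ->
  \sum_(1 <= n < K | smooth y n) n%:R `^ (eta - 1) <=
    expR (4 * (y%:R `^ eta * (3 + 2 * ln J%:R))).
Proof.
move=> /andP[eta0 eta2] J0 yJ.
apply: (@le_trans _ _ (expR ((1 - 3 / 4)^-1 *
    \sum_(1 <= p < y.+1 | prime p) pw (eta - 1) p))).
  apply: (@sum_smooth_le _ (pw (eta - 1)) (3 / 4)) => //; first by lra.
  move=> p pp; apply: le_trans powR2_Nhalf_le.
  have p2 : 2 <= p%:R :> R by rewrite ler_nat prime_gt1.
  apply: (@le_trans _ _ (2 `^ (eta - 1))); first by apply: ler_npowR => //; lra.
  by apply: ler_powR; [lra|lra].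
have -> : (1 - 3 / 4)^-1 = 4 :> R by field; lra.
rewrite ler_expR ler_wpM2l //.
apply: (@le_trans _ _ (\sum_(1 <= p < y.+1 | prime p) y%:R `^ eta * p%:R^-1)).
  rewrite big_nat_cond [leRHS]big_nat_cond; apply: ler_sum => p.
  case/andP=> /andP[p0 py] _.
  have p0' : p%:R != 0 :> R by rewrite pnatr_eq0; lia.
  rewrite /pw powRD ?p0' ?implybT // powR_inv1 //.
  rewrite ler_wpM2r ?invr_ge0 //; apply: ge0_ler_powR; rewrite ?nnegrE //.
  by rewrite ler_nat.
rewrite -mulr_sumr ler_wpM2l ?powR_ge0 //.
apply: (@le_trans _ _ (\sum_(1 <= p < (2 ^ J).+1 | prime p) p%:R^-1)).
  rewrite [leRHS](big_cat_nat _ (n := y.+1)) //= lerDl.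
  exact: sumr_ge0.
apply: le_trans (sum_inv_primes_le J) _.
have : harm J.-1 <= harm J :> R.
  by case: (J) => //= j; rewrite /harm [leRHS]big_nat_recr //= lerDl.
by have := harm_le J0 (R := R); lra.
Qed.

(** Each n <= Y is counted with weight (Y / n)^(1 - eta) >= 1. *)
Lemma cnt_smooth_le (y J Y : nat) (eta : R) : 0 <= eta <= 2^-1 ->
  (0 < J)%N -> (y <= 2 ^ J)%N ->
  cnt Y (smooth y) <= Y%:R * (Y%:R `^ (- eta) *
    expR (4 * (y%:R `^ eta * (3 + 2 * ln J%:R)))).
Proof.
move=> heta J0 yJ; have [Y0|Y0] := posnP Y.
  by rewrite Y0 /cnt big_geq // mul0r.
have Y0' : Y%:R != 0 :> R by rewrite pnatr_eq0; lia.
apply: le_trans (_ : Y%:R `^ (1 - eta) *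
  \sum_(1 <= n < Y.+1 | smooth y n) n%:R `^ (eta - 1) <= _); last first.
  rewrite powRD ?Y0' ?implybT // powRr1 // -mulrA ler_wpM2l // ler_wpM2l ?powR_ge0 //.
  exact: sum_smooth_pow_le.
rewrite mulr_sumr /cnt.
under eq_bigl => n do rewrite asboolb.
rewrite big_nat_cond [leRHS]big_nat_cond; apply: ler_sum => n.
case/andP=> /andP[n0 nY] _.
rewrite -[eta - 1]opprB powRN -ler_pdivrMr ?invr_gt0 ?powR_gt0 ?ltr0n //.
rewrite div1r invrK; case/andP: heta => e0 e1.
by apply: ge0_ler_powR; rewrite ?nnegrE ?subr_ge0 ?ler_nat //; lra.
Qed.

(** Each f > S is counted with the extra weight (f / S)^eta >= 1. *)
Lemma sum_inv_smooth_tail_le (w J K : nat) (eta S : R) : 0 <= eta <= 2^-1 ->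
  (0 < J)%N -> (w <= 2 ^ J)%N -> 0 < S ->
  \sum_(1 <= f < K | smooth w f && (S < f%:R)) f%:R^-1 <=
    S `^ (- eta) * expR (4 * (w%:R `^ eta * (3 + 2 * ln J%:R))).
Proof.
move=> heta J0 wJ S0.
apply: le_trans (_ : S `^ (- eta) *
  \sum_(1 <= n < K | smooth w n) n%:R `^ (eta - 1) <= _); last first.
  by rewrite ler_wpM2l ?powR_ge0 //; exact: sum_smooth_pow_le.
rewrite mulr_sumr.
apply: (@le_trans _ _ (\sum_(1 <= n < K | smooth w n && (S < n%:R))
    S `^ (- eta) * n%:R `^ (eta - 1))); last first.
  apply: sum_nat_sub => [n _|n _ /andP[]//].
  by rewrite mulr_ge0 ?powR_ge0.
apply: ler_sum => n /andP[_ Sn].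
have n0 : 0 < n%:R :> R by apply: lt_trans Sn.
have -> : n%:R^-1 = n%:R `^ (- eta) * n%:R `^ (eta - 1) :> R.
  rewrite -powRD; last by apply/implyP => _; rewrite gt_eqF.
  by rewrite addrA addNr add0r powR_inv1 // ltW.
rewrite ler_wpM2r ?powR_ge0 // ler_npowR //; first exact: ltW.
by rewrite oppr_le0; case/andP: heta.
Qed.

(** Half of the weight 1/g is spent on 1/g <= Z; the other half, g^(-1/2), is summed over the rough
    divisors by (1 + c)^k <= exp (k c). *)
Lemma sum_inv_rough_divisors_le (w k A K : nat) (Z : R) :
  (0 < w)%N -> 0 <= Z -> (0 < A < 2 ^ k)%N ->
  \sum_(1 <= g < K | (g %| A)%N && rough w g && (1 <= g%:R * Z)) g%:R^-1 <=
    Z `^ 2^-1 * expR (k%:R * w%:R `^ (- 2^-1)).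
Proof.
move=> w0 Z0 hA; set c := w%:R `^ (- 2^-1).
have c0 : 0 <= c by exact: powR_ge0.
apply: le_trans (_ : Z `^ 2^-1 *
  \sum_(1 <= g < K | (g %| A)%N && rough w g) pw (- 2^-1) g <= _); last first.
  rewrite ler_wpM2l ?powR_ge0 //.
  apply: le_trans (@sum_rough_divisors_le _ _ c _ _ k _ _ _ _ _ _ hA) _ => //.
    move=> p wp; apply: ler_npowR; rewrite ?ltr0n ?ler_nat ?oppr_le0 //.
    exact: ltnW.
  rewrite expRM_natl.
  by rewrite lerXn2r ?nnegrE ?addr_ge0 ?expR_ge0 // expR_ge1Dx.
rewrite mulr_sumr.
apply: (@le_trans _ _ (\sum_(1 <= g < K | (g %| A)%N && rough w g && (1 <= g%:R * Z))
    Z `^ 2^-1 * pw (- 2^-1) g)); last first.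
  apply: sum_nat_sub => [n _|n _ /andP[]//].
  by rewrite mulr_ge0 ?powR_ge0.
apply: ler_sum => g /andP[/andP[_ rg] gZ].
have g0 : 0 < g%:R :> R by rewrite ltr0n; case/andP: rg.
have -> : g%:R^-1 = g%:R^-1 `^ 2^-1 * pw (- 2^-1) g.
  rewrite /pw -powR_inv1 ?ltW // -powRrM mulN1r -powRD; last by apply/implyP => _; rewrite gt_eqF.
  by congr (_ `^ _); lra.
rewrite ler_wpM2r ?powR_ge0 //.
apply: ge0_ler_powR; rewrite ?nnegrE ?invr_ge0 //.
by rewrite -[leLHS]mul1r ler_pdivrMr // mulrC.
Qed.

End Rankin.

(** * Choice of the parameters in terms of [M] and [V] *)

Section Scales.
Context {R : realType}.
Local Notation trunc := (@Num.truncn R).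

Lemma Sphi_cnt (h : nat) (x : R) :
  (Sphi h x)%:R = cnt (trunc x) (fun n => totient n = totient (n + h)) :> R.
Proof.
rewrite cntE /Sphi; congr _%:R; apply: eq_count => n /=.
by apply/eqP/asboolP.
Qed.

Lemma truncn_half (a : R) : 1 <= a ->
  [/\ (0 < trunc a)%N, (trunc a)%:R <= a & a <= 2 * (trunc a)%:R].
Proof.
move=> a1; have a0 : 0 <= a by lra.
have t0 : (0 < trunc a)%N by rewrite truncn_gt0.
have /andP[ta at1] := truncn_itv a0; split => //.
have : 1 <= (trunc a)%:R :> R by rewrite ler1n.
by move: at1; rewrite -addn1 natrD; lra.
Qed.

Lemma expR_ge1 (a : R) : 0 <= a -> 1 <= expR a.
Proof. by move=> a0; rewrite leNgt expR_lt1 -leNgt. Qed.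

Lemma expR1_ge2 : 2 <= expR 1 :> R.
Proof. by have := expR_ge1Dx (1 : R); lra. Qed.

Lemma expR_half_le2 : expR 2^-1 <= 2 :> R.
Proof.
have := expR_ge1Dx (- 2^-1 : R); rewrite expRN => h.
have e0 := expR_gt0 (2^-1 : R).
have : 2^-1 <= (expR 2^-1)^-1 :> R by lra.
by rewrite lef_pV2 ?posrE.
Qed.

Lemma expR_le_exp2 (a : R) (J : nat) : 2 * a <= J%:R -> expR a <= (2 ^ J)%:R.
Proof.
move=> aJ; apply: (@le_trans _ _ (expR (J%:R * 2^-1))); first by rewrite ler_expR; lra.
by rewrite expRM_natl natrX lerXn2r ?nnegrE ?expR_ge0 // expR_half_le2.
Qed.

(* The scales are [M = ln (ln x)], [L = ln x] and [V = sqrt (ln x * ln (ln x))]. *)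
Local Notation L M := (expR M).
Local Notation x M := (expR (expR M)).
Local Notation W M := (4 * (expR (3 * M / 8) * (7 + 2 * M))).
Local Notation J V := (trunc (2 * V)).+1.
Local Notation w M := (trunc (expR M ^+ 2)).+1.

Lemma scale_le (M V : R) : 1 <= M -> 0 <= V -> V ^+ 2 = expR M * M -> V <= L M.
Proof.
move=> M1 V0 V2; have LM := expR_ge1Dx M.
by rewrite -(ler_pXn2r (ltn0Sn 1)) ?nnegrE // ?V2 ?expR_ge0 //; nra.
Qed.

Lemma le_pow2_scale (V : R) (a : nat) : 0 <= V -> a%:R <= expR V ->
  (a <= 2 ^ J V)%N.
Proof.
move=> V0 aV; rewrite -(ler_nat R); apply: le_trans aV _.
have V20 : 0 <= 2 * V by lra.
by apply: expR_le_exp2; apply: ltW; case/andP: (truncn_itv V20).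
Qed.

(** One bound serves both uses: [a] is y^(M / (4 V)) for the smooth count and w^(1/8) for the smooth
    tail. The 7 + 2 M comes from J <= 3 L <= exp (2 + M). *)
Lemma euler_factor_le (M V a : R) : 1 <= M -> 1 <= V -> V <= L M ->
  0 <= a -> a <= expR (3 * M / 8) ->
  expR (4 * (a * (3 + 2 * ln (J V)%:R))) <= expR (W M).
Proof.
move=> M1 V1 VL a0 aM.
have lnJ : 3 + 2 * ln (J V)%:R <= 7 + 2 * M.
  have V20 : 0 <= 2 * V by lra.
  have /andP[JV _] := truncn_itv V20.
  have : ln (J V)%:R <= ln (expR (2 + M)) :> R.
    rewrite ler_ln ?posrE ?expR_gt0 ?ltr0n //.
    apply: (@le_trans _ _ (3 * L M)); first by rewrite -addn1 natrD; lra.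
    rewrite expRD ler_wpM2r ?expR_ge0 //.
    by have := expR_ge1Dx (2 : R); lra.
  by rewrite expRK; lra.
rewrite ler_expR ler_wpM2l // ler_pM //.
by rewrite addr_ge0 // mulr_ge0 // ln_ge0 // ler1n.
Qed.

Lemma scale_weight_ge0 (M : R) : 1 <= M -> 0 <= W M.
Proof. by move=> M1; rewrite !mulr_ge0 ?expR_ge0 //; lra. Qed.

(** Take eta = M / (4 V). As V^2 = L M, the saving x^(-eta) is exp (- V / 4), while y^eta is only
    exp (M / 4). *)
Lemma cnt_smooth_scale_le (M V : R) (X y : nat) :
  1 <= M -> 0 <= V -> V ^+ 2 = expR M * M ->
  W M + 2 * M + 10 <= V / 80 ->
  x M <= X.*2%:R -> X%:R <= x M -> y%:R <= expR V ->
  2 * cnt X.*2 (smooth y) <= 4 * (x M * expR (- (V / 80))).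
Proof.
move=> M1 V0 V2 HW xY Xx yV; have W0 := scale_weight_ge0 M1.
have V1 : 1 <= V by lra.
have VL := scale_le M1 V0 V2.
have Vpos : 0 < V by lra.
have eta0 : 0 <= M / (4 * V).
  by rewrite divr_ge0 // ?mulr_ge0 // (le_trans _ M1).
have eta_half : 0 <= M / (4 * V) <= 2^-1.
  by rewrite eta0 ler_pdivrMr ?mulr_gt0 //; lra.
have c1 : X.*2%:R `^ (- (M / (4 * V))) <= expR (- (V / 4)).
  have n0 : - (M / (4 * V)) <= 0 by rewrite oppr_le0.
  apply: le_trans (ler_npowR (expR_gt0 _) xY n0) _.
  rewrite -expRM ler_expR le_eqVlt; apply/orP; left; apply/eqP.
  rewrite mulrN mulrA -V2; field; exact: lt0r_neq0.
have c2 : y%:R `^ (M / (4 * V)) <= expR (3 * M / 8).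
  apply: (@le_trans _ _ (expR V `^ (M / (4 * V)))).
    by apply: ge0_ler_powR; rewrite ?nnegrE ?expR_ge0.
  rewrite -expRM ler_expR.
  have -> : V * (M / (4 * V)) = M / 4 by field; exact: lt0r_neq0.
  lra.
have c3 := euler_factor_le M1 V1 VL (powR_ge0 _ _) c2.
have := cnt_smooth_le X.*2 eta_half (ltn0Sn _) (le_pow2_scale V0 yV).
move=> /le_trans c; have {c} := c _ (ler_wpM2l (ler0n _ _)
  (ler_pM (powR_ge0 _ _) (expR_ge0 _) c1 c3)).
rewrite -mul2n natrM => c.
apply: (@le_trans _ _ (4 * (X%:R * expR (- (V / 4) + W M)))).
  have -> (e : R) : 4 * (X%:R * e) = 2 * (2 * X%:R * e) by ring.
  by rewrite ler_wpM2l // expRD.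
by rewrite ler_wpM2l // ler_pM ?expR_ge0 // ler_expR; lra.
Qed.

(** Take eta = 1/8: S = exp (V / 5) saves exp (- V / 40), and w <= L^3 gives w^eta <= exp (3 M /
    8). *)
Lemma sum_inv_smooth_scale_le (M V : R) (K : nat) :
  1 <= M -> 0 <= V -> V ^+ 2 = expR M * M ->
  W M + 2 * M + 10 <= V / 80 ->
  \sum_(1 <= f < K | smooth (w M) f && (expR (V / 5) < f%:R)) f%:R^-1 <=
    expR (- (V / 40) + W M).
Proof.
move=> M1 V0 V2 HW; have W0 := scale_weight_ge0 M1.
have V1 : 1 <= V by lra.
have VL := scale_le M1 V0 V2; have LM := expR_ge1Dx M.
have /andP[wL _] := truncn_itv (exprn_ge0 2 (expR_ge0 M)).
have wL3 : (w M)%:R <= expR (3 * M).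
  rewrite expRM_natl -addn1 natrD; apply: (@le_trans _ _ (L M ^+ 2 + 1)); first by lra.
  have L1 : 1 <= L M ^+ 2 by rewrite expr2; nra.
  by rewrite exprSr; nra.
have wJ : (w M <= 2 ^ J V)%N.
  by apply: le_pow2_scale V0 _; apply: le_trans wL3 _; rewrite ler_expR; lra.
have eta8 : 0 <= (8^-1 : R) <= 2^-1 by apply/andP; split; lra.
apply: le_trans (sum_inv_smooth_tail_le _ eta8 (ltn0Sn _) wJ (expR_gt0 _)) _.
rewrite expRD; apply: ler_pM; rewrite ?powR_ge0 ?expR_ge0 //.
  by rewrite -expRM ler_expR; lra.
apply: euler_factor_le; rewrite ?powR_ge0 //.
apply: (@le_trans _ _ (expR (3 * M) `^ 8^-1)); last by rewrite -expRM.
by apply: ge0_ler_powR; rewrite ?nnegrE ?expR_ge0.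
Qed.

(** Here Z = S D / y is at most exp (1 - 3 V / 5), and its square root gives the saving. The
    remaining factor is at most exp 3, because k <= 3 L and w^(-1/2) <= 1 / L. *)
Lemma sum_inv_rough_scale_le (M V : R) (X y D A : nat) :
  5 <= L M -> 0 <= V -> X%:R <= x M -> (0 < y)%N ->
  expR V <= 2 * y%:R -> D%:R <= expR (V / 5) -> (0 < A <= X.*2)%N ->
  \sum_(1 <= g < X.*2.+1 | (g %| A)%N && rough (w M) g
      && (y%:R <= g%:R * (expR (V / 5) * D%:R))) g%:R^-1 <=
    expR (4 - 3 * V / 10).
Proof.
move=> L5 V0 Xx y0 Vy DV /andP[A0 AY]; set S := expR (V / 5) in DV *.
have /andP[_ Lw] := truncn_itv (exprn_ge0 2 (expR_ge0 M)).
(* The 5 ensures k >= 2 (2 + L), so that 2 X < exp (2 + L) <= 2^k. *)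
pose k := (trunc (2 * L M) + 5)%N.
have L20 : 0 <= 2 * L M by lra.
have /andP[kL Lk] := truncn_itv L20; rewrite -[X in _ < X%:R]addn1 natrD in Lk.
have ke : k%:R = (trunc (2 * L M))%:R + 5 :> R by rewrite /k natrD.
have Ak : (0 < A < 2 ^ k)%N.
  rewrite A0 (leq_ltn_trans AY) // -(ltr_nat R).
  apply: lt_le_trans (_ : expR (2 + L M) <= _); last by apply: expR_le_exp2; lra.
  rewrite -mul2n natrM expRD; have e2 := expR_ge1Dx (2 : R).
  apply: (@le_lt_trans _ _ (2 * x M)); first by rewrite ler_wpM2l.
  by rewrite ltr_pM2r ?expR_gt0 //; lra.
have y0' : 0 < y%:R :> R by rewrite ltr0n.
have Z0 : 0 <= S * D%:R / y%:R by rewrite !mulr_ge0 ?invr_ge0 ?expR_ge0.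
apply: (@le_trans _ _ ((S * D%:R / y%:R) `^ 2^-1 * expR (k%:R * (w M)%:R `^ (- 2^-1)))).
  apply: le_trans (sum_inv_rough_divisors_le X.*2.+1 (ltn0Sn _) Z0 Ak).
  apply: sum_nat_sub => // g _ /andP[-> le] /=.
  by rewrite mulrA ler_pdivlMr // mul1r.
have kw : k%:R * (w M)%:R `^ (- 2^-1) <= 3 :> R.
  apply: (@le_trans _ _ ((3 * L M) * (L M)^-1)); last by rewrite mulfK // gt_eqF ?expR_gt0.
  apply: ler_pM; rewrite ?powR_ge0 //; first by lra.
  have h0 : - 2^-1 <= 0 :> R by rewrite oppr_le0.
  apply: le_trans (ler_npowR (exprn_gt0 2 (expR_gt0 M)) (ltW Lw) h0) _.
  by rewrite -expRM_natl -expRM -expRN ler_expR; lra.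
have hZ : (S * D%:R / y%:R) `^ 2^-1 <= expR (1 - 3 * V / 10).
  apply: (@le_trans _ _ (expR (1 - 3 * V / 5) `^ 2^-1)); last first.
    by rewrite -expRM ler_expR; lra.
  apply: ge0_ler_powR; rewrite ?nnegrE ?expR_ge0 // ler_pdivrMr //.
  apply: (@le_trans _ _ (S * S)); first by rewrite ler_wpM2l ?expR_ge0.
  have -> : S * S = expR (1 - 3 * V / 5) * (expR V * expR (- 1)).
    by rewrite -!expRD; congr expR; lra.
  rewrite ler_wpM2l ?expR_ge0 // expRN ler_pdivrMr ?expR_gt0 //.
  apply: le_trans Vy _; rewrite mulrC ler_wpM2l //; exact: expR1_ge2.
have -> : 4 - 3 * V / 10 = (1 - 3 * V / 10) + 3 by ring.
by rewrite expRD; apply: ler_pM => //; rewrite ?powR_ge0 ?expR_ge0 // ler_expR.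
Qed.

(** With y about exp V, D about exp (V / 5), S = exp (V / 5) and Q = X exp (- V / 10), the weakest
    saving is the exp (- V / 40) of the smooth parts. Half of it absorbs W and the power of L. The
    constant is 160 = 4 + 12 + 18 + 54 + 18 + 54. *)
Lemma Sphi_le (M V : R) (h : nat) :
  1 <= M -> 0 <= V -> V ^+ 2 = expR M * M ->
  W M + 2 * M + 10 <= V / 80 ->
  odd h -> h%:R <= expR V ->
  (Sphi h (x M))%:R <= 160 * (x M * expR (- (V / 80))).
Proof.
move=> M1 V0 V2 HW oh hV; have W0 := scale_weight_ge0 M1.
have VL := scale_le M1 V0 V2; have LM := expR_ge1Dx M.
have L5 : 5 <= L M by lra.
have absorb (c b a X : R) : 0 <= c -> 0 <= X -> X <= x M -> a <= - (V / 80) ->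
    b = c * (X * expR a) -> b <= c * (x M * expR (- (V / 80))).
  move=> c0 X0 Xx aV ->; rewrite ler_wpM2l // ler_pM ?expR_ge0 //.
  by rewrite ler_expR.
have a2 : - V <= - (V / 80) by lra.
have a3 : 2 * M - V / 10 <= - (V / 80) by lra.
have a4 : V / 10 - V / 5 + 2 * M <= - (V / 80) by lra.
have a5 : M + (- (V / 40) + W M) <= - (V / 80) by lra.
have a6 : 2 * M + (4 - 3 * V / 10) <= - (V / 80) by lra.
have x1 : 1 <= x M by apply: expR_ge1; exact: expR_ge0.
have hX : (h <= trunc (x M))%N.
  by rewrite truncn_ge_nat ?expR_ge0 // (le_trans hV) // ler_expR.
rewrite Sphi_cnt.
have [X0 Xx xX] := truncn_half x1; move: (trunc (x M)) hX X0 Xx xX => X hX X0 Xx xX.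
have xY : x M <= X.*2%:R by rewrite -mul2n natrM.
have y1 : 1 <= expR V by exact: expR_ge1.
have hy : (h <= trunc (expR V))%N by rewrite truncn_ge_nat ?expR_ge0.
have [y0 yV Vy] := truncn_half y1.
move: (trunc (expR V)) hy y0 yV Vy => y hy y0 yV Vy.
have D1 : 1 <= expR (V / 5) by apply: expR_ge1; lra.
have [D0 DV VD] := truncn_half D1; move: (trunc _) D0 DV VD => D D0 DV VD.
have y2 : (1 < y)%N.
  by rewrite -(ltr_nat R); have := expR_ge1Dx V; clear -Vy HW W0 M1; lra.
set Q := X%:R * expR (- (V / 10)).
have X0' : 0 < X%:R :> R by rewrite ltr0n.
have X0'' := ltW X0'.
have hQ : 0 < Q <= X%:R.
  rewrite mulr_gt0 ?expR_gt0 //= ler_piMr // expR_le1 oppr_le0.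
  by rewrite divr_ge0.
have H3 : harm X.*2 <= 3 * expR M :> R.
  have h2 : (0 < X.*2)%N by rewrite double_gt0.
  apply: le_trans (harm_le h2) _.
  have : ln X.*2%:R <= ln (expR (1 + L M)) :> R.
    rewrite ler_ln ?posrE ?expR_gt0 ?ltr0n // -mul2n natrM expRD.
    by rewrite ler_pM // expR1_ge2.
  by rewrite expRK; clear -LM M1; lra.
have H0 := harm_ge0 X.*2 (R := R).
have H9 : harm X.*2 ^+ 2 <= 9 * expR (2 * M) :> R.
  have -> : 9 * expR (2 * M) = (3 * expR M) ^+ 2 by rewrite expRM_natl; ring.
  by rewrite lerXn2r ?nnegrE // mulr_ge0 ?expR_ge0.
apply: le_trans (cnt_totient_shift oh hX hy y2 D0 (expR_ge0 (V / 5)) hQ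
  (expR_ge0 _) (fun A => sum_inv_rough_scale_le L5 V0 Xx y0 Vy DV)) _.
have T1 := cnt_smooth_scale_le M1 V0 V2 HW xY Xx yV.
have T2 : 6 * X%:R / y%:R <= 12 * (x M * expR (- (V / 80))).
  apply: le_trans (absorb 12 _ _ _ _ X0'' Xx a2 (erefl _)) => //.
  rewrite ler_pdivrMr ?ltr0n // expRN.
  have -> : 12 * (X%:R / expR V) * y%:R = 6 * X%:R * (2 * y%:R / expR V).
    by field; exact: lt0r_neq0 (expR_gt0 _).
  by rewrite ler_peMr ?mulr_ge0 // ler_pdivlMr ?expR_gt0 // mul1r.
have T3 : 2 * Q * harm X.*2 ^+ 2 <= 18 * (x M * expR (- (V / 80))).
  apply: le_trans (absorb 18 _ _ _ _ X0'' Xx a3 (erefl _)) => //.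
  have -> : 18 * (X%:R * expR (2 * M - V / 10)) = 2 * Q * (9 * expR (2 * M)).
    by rewrite /Q expRD; ring.
  by rewrite ler_wpM2l // mulr_ge0 // ltW; case/andP: hQ.
have T4 : 3 * X%:R ^+ 2 / Q / D%:R * harm X.*2 ^+ 2 <=
    54 * (x M * expR (- (V / 80))).
  apply: le_trans (absorb 54 _ _ _ _ X0'' Xx a4 (erefl _)) => //.
  have -> : 54 * (X%:R * expR (V / 10 - V / 5 + 2 * M)) =
      3 * X%:R * expR (V / 10) * (2 * expR (- (V / 5))) * (9 * expR (2 * M)).
    by rewrite !expRD; ring.
  have -> : 3 * X%:R ^+ 2 / Q = 3 * X%:R * expR (V / 10).
    by rewrite /Q expRN; field; rewrite !gt_eqF ?expR_gt0.
  have Di : D%:R^-1 <= 2 * expR (- (V / 5)).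
    rewrite expRN ler_pdivlMr ?expR_gt0 // mulrC ler_pdivrMr ?ltr0n //.
  apply: ler_pM => //; first by rewrite !mulr_ge0 ?invr_ge0 ?expR_ge0.
  by rewrite ler_wpM2l // !mulr_ge0 ?expR_ge0.
have T5 : 6 * X%:R * harm X.*2 * (\sum_(1 <= f < X.*2.+1 |
    smooth (w M) f && (expR (V / 5) < f%:R)) f%:R^-1) <=
    18 * (x M * expR (- (V / 80))).
  apply: le_trans (absorb 18 _ _ _ _ X0'' Xx a5 (erefl _)) => //.
  have -> : 18 * (X%:R * expR (M + (- (V / 40) + W M))) =
      6 * X%:R * (3 * expR M) * expR (- (V / 40) + W M).
    by rewrite [expR (M + _)]expRD; ring.
  apply: ler_pM; [by rewrite !mulr_ge0|by apply: sumr_ge0| |].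
    by rewrite ler_wpM2l ?mulr_ge0.
  exact: sum_inv_smooth_scale_le.
have T6 : 6 * X%:R * harm X.*2 ^+ 2 * expR (4 - 3 * V / 10) <=
    54 * (x M * expR (- (V / 80))).
  apply: le_trans (absorb 54 _ _ _ _ X0'' Xx a6 (erefl _)) => //.
  have -> : 54 * (X%:R * expR (2 * M + (4 - 3 * V / 10))) =
      6 * X%:R * (9 * expR (2 * M)) * expR (4 - 3 * V / 10).
    by rewrite [expR (2 * M + _)]expRD; ring.
  by rewrite ler_wpM2r ?expR_ge0 // ler_wpM2l ?mulr_ge0.
have -> : 160 * (x M * expR (- (V / 80))) = 4 * (x M * expR (- (V / 80))) +
    12 * (x M * expR (- (V / 80))) + 18 * (x M * expR (- (V / 80))) +
    54 * (x M * expR (- (V / 80))) + 18 * (x M * expR (- (V / 80))) +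
    54 * (x M * expR (- (V / 80))) by ring.
by do 5! apply: lerD => //.
Qed.

End Scales.

(** * Comparison of [V] with the error weight and with [G], and the theorem *)

(** In terms of z = exp (M / 16), V is at least z^8, while the left side is at most 198 z^7, where
    198 = 4 * 39 + 42; so z >= 80 * 198 suffices. The second claim will give (log x)^a <= exp V. *)
Lemma weight_le_scale (R : realType) (a M V : R) : 0 <= a ->
  16 * (80 * 198 + 16 * a) <= M -> 0 <= V -> V ^+ 2 = expR M * M ->
  4 * (expR (3 * M / 8) * (7 + 2 * M)) + 2 * M + 10 <= V / 80 /\ M * a <= V.
Proof.
move=> a0 MM V0 V2; set z := expR (M / 16).
have zM : 1 + M / 16 <= z by exact: expR_ge1Dx.
have z0 : 0 <= z by exact: expR_ge0.
have -> : expR (3 * M / 8) = z ^+ 6 by rewrite /z -expRM_natl; congr expR; lra.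
have eM : expR M = z ^+ 16 by rewrite /z -expRM_natl; congr expR; lra.
have zV : z ^+ 8 <= V.
  rewrite -(ler_pXn2r (ltn0Sn 1)) ?nnegrE ?exprn_ge0 // V2 eM -exprM.
  by rewrite ler_peMr ?exprn_ge0 //; lra.
move: (z) z0 zM zV => {V2 eM} {}z z0 zM zV.
have z1 : 1 <= z by lra.
have z6 : 0 <= z ^+ 6 by rewrite exprn_ge0.
have z7 : z <= z ^+ 7 by rewrite exprS ler_peMr // exprn_ege1.
have z78 : 80 * 198 * z ^+ 7 <= z ^+ 8.
  by rewrite [z ^+ 8]exprS ler_wpM2r ?exprn_ge0 //; lra.
have az : 16 * a * z <= z ^+ 8.
  apply: (@le_trans _ _ (z * z)); first by rewrite ler_wpM2r //; lra.
  by rewrite exprS ler_wpM2l // (le_trans z7) // exprn_ege1.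
split; last first.
  apply: le_trans zV; apply: le_trans az.
  by rewrite mulrC [16 * a]mulrC -mulrA ler_wpM2l //; lra.
have : z ^+ 6 * (7 + 2 * M) <= 39 * z ^+ 7.
  have -> : 39 * z ^+ 7 = z ^+ 6 * (39 * z) by ring.
  by rewrite ler_wpM2l //; lra.
lra.
Qed.

(** Since ln M <= 2 sqrt M, [calA x] is at most 4 sqrt M, so G^2 <= 4 L sqrt M against V^2 = L M.
    Squaring the claim leaves (160 B)^2 <= sqrt M, with 160 = 2 * 80. *)
Lemma G_le_scale (R : realType) (B x : R) (M := ln (ln x)) : 0 <= B -> 1 < M ->
  ((160 * B) ^+ 2) ^+ 2 <= M -> 0 <= ln x ->
  B * G x <= Num.sqrt (ln x * M) / 80.
Proof.
move=> B0 M1 BM L0; have M0 : 0 < M by lra.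
set s := Num.sqrt M.
have s0 : 0 < s by rewrite sqrtr_gt0.
have s2 : s ^+ 2 = M by rewrite sqr_sqrtr // ltW.
have A4 : calA x <= 4 * s.
  have lM : ln M <= 2 * s.
    by rewrite -s2 lnXn // mulr2n; have := ln_sublinear s0; lra.
  have llM := ln_sublinear (ln_gt0 M1).
  have l2 : 0 <= ln 2 :> R by rewrite ln_ge0 // ler1n.
  rewrite /calA /iter_ln /= -/M; lra.
have Bs : (160 * B) ^+ 2 <= s.
  rewrite -(ler_pXn2r (ltn0Sn 1)) ?nnegrE ?s2 //; last exact: ltW.
  exact: sqr_ge0.
apply: (@le_trans _ _ (B * Num.sqrt (ln x * (4 * s)))).
  by rewrite ler_wpM2l // /G ler_wsqrtr // ler_wpM2l.
rewrite -(ler_pXn2r (ltn0Sn 1)) ?nnegrE; last 2 first.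
- by rewrite mulr_ge0 // sqrtr_ge0.
- by rewrite divr_ge0 // sqrtr_ge0.
rewrite !exprMn !sqr_sqrtr; last 2 first.
- by rewrite mulr_ge0 // ltW.
- by rewrite !mulr_ge0 // ltW.
rewrite -s2 mulrCA -[leRHS]mulrA ler_wpM2l //.
have : (160 * B) ^+ 2 * s <= s * s by rewrite ler_wpM2r // ltW.
by rewrite exprVn exprMn [s ^+ 2]expr2; nra.
Qed.

Unset Implicit Arguments.

Theorem corollary1p3 (R : realType) (B A0 : R) (hB : 0 < B) (hA0 : 0 < A0) :
  exists C x0 : R, 0 < C /\
    forall (x : R) (h : nat), x0 <= x -> odd h -> h%:R <= ln x `^ A0 ->
      (Sphi h x)%:R <= C * (x * expR (- (B * G x))).
Proof.
set M0 := 16 * (80 * 198 + 16 * A0) + ((160 * B) ^+ 2) ^+ 2.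
(* The constant is absolute; the dependence on [B] and [A0] lies in the threshold, where [M0] adds
   the requirements of the two comparison lemmas. *)
exists 160, (expR (expR M0)); split => // x h x0x oh hx.
have x0 : 0 < x by apply: lt_le_trans x0x; exact: expR_gt0.
have L0x : expR M0 <= ln x by rewrite -[leLHS]expRK ler_ln ?posrE ?expR_gt0.
have L0 : 0 < ln x by apply: lt_le_trans L0x; exact: expR_gt0.
set M := ln (ln x).
have MM : M0 <= M by rewrite -[leLHS]expRK ler_ln ?posrE ?expR_gt0.
have eL : expR M = ln x by rewrite lnK.
have ex : x = expR (expR M) by rewrite eL lnK.
have B2 : 0 <= ((160 * B) ^+ 2) ^+ 2 by rewrite sqr_ge0.
have M1 : 1 < M by move: MM; rewrite /M0; lra.
have MB : ((160 * B) ^+ 2) ^+ 2 <= M by move: MM; rewrite /M0; lra.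
set V := Num.sqrt (ln x * M).
have V0 : 0 <= V by exact: sqrtr_ge0.
have V2 : V ^+ 2 = expR M * M by rewrite eL sqr_sqrtr // mulr_ge0 //; lra.
have [] := weight_le_scale (ltW hA0) _ V0 V2; first by move: MM; rewrite /M0; lra.
move=> HW MA.
have hV : h%:R <= expR V.
  by apply: le_trans hx _; rewrite -eL -expRM ler_expR.
have BG : B * G x <= V / 80.
  by apply: G_le_scale => //; exact: ltW.
rewrite {1}ex; apply: le_trans (Sphi_le (ltW M1) V0 V2 HW oh hV) _.
by rewrite -ex ler_wpM2l // ler_wpM2l ?(ltW x0) // ler_expR lerN2.
Qed.
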